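(* Let $n\ge1$ and let $\lambda$ be a partition of $n$. The elliptic fake degree of $[\lambda\times\emptyset]\in\overline R(W(B_n))$ is $$F^{B_n}_{[\lambda\times\emptyset]}=(q-1)^n\,q^{2n(\lambda)}\prod_{(i,j)\in\lambda}\frac{1-q^{2c(i,j)+1}}{1-q^{2h(i,j)}} .$$
   Context: $W=W(B_n)$ is the hyperoctahedral group acting on its reflection representation $E=\mathbb R^n$. Its irreducible representations are parameterized by pairs of partitions $(\lambda,\gamma)$ of total size $n$, written $\lambda\times\gamma$, normalized so that $(n)\times\emptyset$ is trivial and $(\lambda\times\gamma)\otimes\mathrm{sgn}=\gamma^t\times\lambda^t$; in particular $\lambda\times\emptyset$ is the inflation to $W(B_n)$ of the irreducible $S_n$-representation $\sigma_\lambda$ through $W(B_n)\to S_n$, where $\sigma_{(n)}$ is trivial and $\sigma_{(1^n)}=\mathrm{sgn}$. The elliptic pairing is $\langle\sigma,\sigma'\rangle^{\mathrm{ell}}_W=\frac1{|W|}\sum_{w\in W}\sigma(w)\sigma'(w)\det_E(1-w)$ on the Grothendieck group $R(W)$, and $\overline R(W)=R(W)/\mathrm{rad}\langle\,,\,\rangle^{\mathrm{ell}}_W$. For $[\pi]\in\overline R(W)$ the elliptic fake degree is $F_{[\pi]}=\frac{(q-1)^{\dim E}}{|W|}\sum_{w\in W}\pi(w)\frac{\det_E(1-w)}{\det_E(1-qw)}\in\mathbb Q(q)$. For $\lambda=(\lambda_1\ge\lambda_2\ge\dots)$ viewed as a Young diagram (box $(i,j)$ in row $i$, column $j$): $n(\lambda)=\sum_i(i-1)\lambda_i$,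 $c(i,j)=j-i$ is the content, and $h(i,j)$ is the hook length of the box $(i,j)$. *)

(* Defs.v *)
From HB Require Import structures.
From mathcomp Require Import all_boot all_order all_algebra all_fingroup.
From mathcomp Require Import all_solvable all_field all_character.

Set Implicit Arguments.
Unset Strict Implicit.
Unset Printing Implicit Defensive.

Import GRing.Theory Num.Theory.
Local Open Scope ring_scope.

(* The base field of algC is the algebraic closure of Q, so the field of      *)
(* rational functions below contains Q(q).                                    *)
Notation ratfun := {fraction {poly algC}}.

Definition qvar : ratfun := tofrac 'X.
Definition const_ratfun (c : algC) : ratfun := tofrac c%:P.

(* The Grothendieck group R(G), realized as the group of virtual characters.  *)
Section VirtualCharacters.

Variables (gT : finGroupType) (G : {group gT}).

Record vchar := VChar { vchar_val :> 'CF(G); vchar_valP : vchar_val \in 'Z[irr G]%g }.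

HB.instance Definition _ := [isSub for vchar_val].
HB.instance Definition _ := [Choice of vchar by <:].
HB.instance Definition _ := [SubChoice_isSubZmodule of vchar by <:].

Definition vchar_of_repr m (rG : mx_representation algC G m) : vchar :=
  VChar (char_vchar (cfRepr_char rG)).

End VirtualCharacters.

Section Elliptic.

Variables (gT : finGroupType) (G : {group gT}) (n : nat).
Variable E : mx_representation algC G n.

Definition det_one_sub (w : gT) : algC := \det (1%:M - E w).

Definition det_one_sub_q (w : gT) : ratfun :=
  \det (1%:M - qvar *: map_mx const_ratfun (E w)).

Definition ell_pairing (phi psi : 'CF(G)) : algC :=
  #|G|%:R^-1 * \sum_(w in G) phi w * psi w * det_one_sub w.

(* Testing against the irreducible characters makes membership boolean;       *)
(* see ell_radP for the usual definition of the radical.                      *)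
Definition ell_rad : {pred vchar G} :=
  [pred x : vchar G | [forall i : Iirr G, ell_pairing x 'chi_i == 0]].

Lemma ell_pairing_eq0_det (phi : 'CF(G)) :
  (forall i : Iirr G, ell_pairing phi 'chi_i = 0) ->
  {in G, forall w, phi w * det_one_sub w = 0}.
Proof.
move=> phi0.
have detJ : {in G &, forall x y, det_one_sub (x ^ y)%g = det_one_sub x}.
  move=> x y Gx Gy; have yVy : E y^-1%g *m E y = 1%:M.
    by rewrite -repr_mxM ?groupV // mulVg repr_mx1.
  rewrite /det_one_sub conjgE !repr_mxM ?groupM ?groupV //.
  have -> : 1%:M - E y^-1%g *m (E x *m E y) = E y^-1%g *m (1%:M - E x) *m E y.
    by rewrite mulmxBr mulmxBl mulmx1 yVy mulmxA.
  by rewrite !det_mulmx mulrAC -det_mulmx yVy det1 mul1r.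
pose f w := if w \in G then (phi w * det_one_sub w)^* else 0.
have fP : is_class_fun <<G>>%g [ffun w => f w].
  rewrite genGid; apply: intro_class_fun => [x y Gx Gy|x notGx]; rewrite /f.
    by rewrite groupJ // Gx cfunJ // detJ.
  by rewrite (negbTE notGx).
pose F : 'CF(G) := Cfun 0 fP.
have F0 : F = 0.
  apply/cfun_inP => w Gw; rewrite (cfun_sum_cfdot F) sum_cfunE cfunE.
  apply: big1 => i _; rewrite cfunE.
  suff -> : '[F, 'chi_i] = 0 by rewrite mul0r.
  rewrite cfdotC cfdotE.
  have := phi0 i; rewrite /ell_pairing => H.
  suff -> : \sum_(x in G) 'chi_i x * (F x)^* =
     \sum_(w in G) phi w * 'chi_i w * det_one_sub w by rewrite H conjC0.
  apply: eq_bigr => x Gx; rewrite cfunE /= /f Gx conjCK.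
  by rewrite mulrCA mulrA.
move=> w Gw; have := congr1 (fun h : 'CF(G) => h w) F0.
rewrite cfunE /= /f Gw cfunE => /eqP; rewrite conjC_eq0 => /eqP //.
Qed.

Lemma ell_radP (x : vchar G) :
  reflect (forall y : vchar G, ell_pairing x y = 0) (x \in ell_rad).
Proof.
apply: (iffP forallP) => [x0 y | x0 i]; last first.
  exact/eqP/(x0 (VChar (irr_vchar i))).
have x0' i := eqP (x0 i).
rewrite /ell_pairing big1 ?mulr0 // => w Gw.
by rewrite mulrAC (ell_pairing_eq0_det x0') // mul0r.
Qed.

Fact ell_rad_zmod : zmod_closed ell_rad.
Proof.
split=> [|x y /ell_radP x0 /ell_radP y0]; apply/ell_radP => z.
  by rewrite /ell_pairing big1 ?mulr0 // => w _; rewrite cfunE !mul0r.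
transitivity (ell_pairing x z - ell_pairing y z); last first.
  by rewrite x0 y0 subrr.
rewrite /ell_pairing -mulrBr -sumrB; congr (_ * _).
by apply: eq_bigr => w _; rewrite !cfunE !mulrBl.
Qed.
HB.instance Definition _ :=
  GRing.isZmodClosed.Build (vchar G) ell_rad ell_rad_zmod.

(* {ideal_quot I}, as this type is printed, is the quotient of an abelian     *)
(* group by any subgroup I.                                                   *)
Definition Rbar : zmodType := Quotient.quot ell_rad.

Definition ell_class (x : vchar G) : Rbar := (\pi_(Quotient.quot ell_rad) x)%qT.

Definition ell_fake_degree_cf (phi : 'CF(G)) : ratfun :=
  (qvar - 1) ^+ n / #|G|%:R *
  \sum_(w in G)
     const_ratfun (phi w) * (const_ratfun (det_one_sub w) / det_one_sub_q w).

Definition ell_fake_degree (x : Rbar) : ratfun :=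
  ell_fake_degree_cf (generic_quotient.repr (x : Quotient.quot ell_rad)).

(* The elliptic fake degree of a class can be computed on any representative. *)
Lemma ell_fake_degreeE (x : vchar G) :
  ell_fake_degree (ell_class x) = ell_fake_degree_cf x.
Proof.
rewrite /ell_fake_degree; set y := generic_quotient.repr _.
have /forallP Iyx : y - x \in ell_rad.
  by rewrite Quotient.idealrBE reprK.
have yx0 := ell_pairing_eq0_det (fun i => eqP (Iyx i)).
rewrite /ell_fake_degree_cf; congr (_ * _); apply: eq_bigr => w Gw.
rewrite !mulrA -!tofracM -!polyCM; congr (tofrac _%:P / _).
by apply/eqP; rewrite -subr_eq0 -mulrBl; have := yx0 w Gw; rewrite !cfunE => ->.
Qed.

End Elliptic.

(* W(B_n) as the group of signed permutations: the permutations of the        *)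
(* signed indices (i, false) = +i and (i, true) = -i that commute with the    *)
(* sign change.                                                               *)
Section Hyperoctahedral.

Variable n : nat.

Notation sindex := ('I_n * bool)%type.

Definition neg_index (x : sindex) : sindex := (x.1, ~~ x.2).

Fact neg_index_inj : injective neg_index.
Proof. by case=> i a [j b] [-> /negb_inj ->]. Qed.

Definition neg_perm : {perm sindex} := perm neg_index_inj.

Definition hyperoctahedral : {group {perm sindex}} := 'C[neg_perm]%G.

Lemma hyperoctahedralN w x :
  w \in hyperoctahedral -> w (neg_index x) = neg_index (w x).
Proof.
move=> /cent1P /(congr1 (fun s : {perm sindex} => s x)).
by rewrite !permM !permE.
Qed.

(* The action on R^n, with scalars extended to algC: row i is the image of    *)
(* the i-th basis vector, namely the basis vector of w(i) up to sign.         *)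
Definition refl_mx (w : {perm sindex}) : 'M[algC]_n :=
  \matrix_(i, j) if (w (i, false)).1 == j then (-1) ^+ (w (i, false)).2 else 0.

Lemma refl_mx_repr : mx_repr hyperoctahedral refl_mx.
Proof.
split=> [|s t Ws Wt]; apply/matrixP=> i j; rewrite !mxE.
  by rewrite perm1 /=; case: eqP.
rewrite (bigD1 (s (i, false)).1) //= big1 ?addr0 => [|k /negbTE nk]; last first.
  by rewrite !mxE eq_sym nk mul0r.
rewrite !mxE eqxx permM; case Es: (s (i, false)) => [k [|]] /=; last first.
  by rewrite mul1r.
have -> : (k, true) = neg_index (k, false) by [].
rewrite hyperoctahedralN //=; case: eqP => _; last by rewrite mulr0.
by case: (_.2); rewrite /= ?mulrNN ?mulr1 ?mul1r // mulN1r.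
Qed.

Definition refl_repr := MxRepresentation refl_mx_repr.

(* The unsigned permutation underlying w; the default value 1 is only used    *)
(* outside W(B_n).                                                            *)
Definition unsigned (w : {perm sindex}) : 'S_n :=
  insubd (1%g : 'S_n) [ffun i => (w (i, false)).1].

Lemma unsignedE w i : w \in hyperoctahedral -> unsigned w i = (w (i, false)).1.
Proof.
move=> Ww.
have wK : injectiveb [ffun i => (w (i, false)).1].
  apply/injectiveP => j k; rewrite !ffunE => Ejk.
  have [Eb | nEb] := eqVneq (w (j, false)).2 (w (k, false)).2.
    have /perm_inj[//] : w (j, false) = w (k, false).
    by rewrite [LHS]surjective_pairing Ejk Eb -surjective_pairing.
  have : w (j, false) = w (neg_index (k, false)).
    rewrite hyperoctahedralN // [LHS]surjective_pairing Ejk /neg_index.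
    by congr (_, _); case: (_.2) nEb; case: (_.2).
  by move/perm_inj.
by rewrite /unsigned -pvalE val_insubd wK ffunE.
Qed.

Lemma unsignedM : {in hyperoctahedral &, {morph unsigned : s t / (s * t)%g}}.
Proof.
move=> s t Ws Wt; apply/permP=> i.
rewrite permM !unsignedE ?groupM // permM.
case Es: (s (i, false)) => [k [|]] //=.
have -> : (k, true) = neg_index (k, false) by [].
by rewrite hyperoctahedralN.
Qed.

Canonical unsigned_morphism := Morphism unsignedM.

Lemma inflate_mx_repr m (rS : mx_representation algC [set: 'S_n] m) :
  mx_repr hyperoctahedral (fun w => rS (unsigned w)).
Proof.
split=> [|s t Ws Wt]; first by rewrite morph1 repr_mx1.
by rewrite unsignedM // repr_mxM ?inE.
Qed.

Definition inflate_repr m (rS : mx_representation algC [set: 'S_n] m) :=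
  MxRepresentation (inflate_mx_repr rS).

End Hyperoctahedral.

Definition is_partition (n : nat) (lam : seq nat) : bool :=
  [&& sorted geq lam, 0%N \notin lam & sumn lam == n].

(* Rows and columns are numbered from 0, so that the boxes of lam are the     *)
(* pairs (i, j) with i < size lam and j < lam_i.                              *)
Definition part_n (lam : seq nat) : nat :=
  (\sum_(i < size lam) i * nth 0 lam i)%N.

Definition content (i j : nat) : int := j%:Z - i%:Z.

Definition col_length (lam : seq nat) (j : nat) : nat :=
  count (fun r => j < r)%N lam.

(* arm + leg + 1 *)
Definition hook_length (lam : seq nat) (i j : nat) : nat :=
  ((nth 0 lam i - j.+1) + (col_length lam j - i.+1)).+1.

(* The irreducible representation sigma_lam of S_n, as the right ideal of the *)
(* group algebra generated by the Young symmetrizer of the tableau of shape   *)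
(* lam filled row by row: k lies in row reshape_index lam k and column        *)
(* reshape_offset lam k.                                                      *)
Section Specht.

Variables (n : nat) (lam : seq nat).

Definition row_stab : {set 'S_n} :=
  [set s : 'S_n | [forall k : 'I_n, reshape_index lam (s k) == reshape_index lam k]].

Definition col_stab : {set 'S_n} :=
  [set s : 'S_n | [forall k : 'I_n, reshape_offset lam (s k) == reshape_offset lam k]].

(* The basis vector of the group algebra attached to s.                       *)
Definition gring_basis (s : 'S_n) : 'rV[algC]_(gcard [set: 'S_n]) :=
  delta_mx 0 (gring_index [set: 'S_n] s).

Definition young_symmetrizer : 'rV[algC]_(gcard [set: 'S_n]) :=
  \sum_(s in row_stab) \sum_(t in col_stab)
     (-1) ^+ odd_perm t *: gring_basis (s * t)%g.

Definition specht_repr :=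
  submod_repr (cyclic_mx_module (regular_repr algC [set: 'S_n])
                                young_symmetrizer).

End Specht.

(* The element lam x 0 of R(W(B_n)).                                          *)
Definition bipart_empty (n : nat) (lam : seq nat) : vchar (hyperoctahedral n) :=
  vchar_of_repr (inflate_repr (specht_repr n lam)).

(* Main.v *)
Require Import Defs.
From mathcomp Require Import all_boot all_order all_algebra all_fingroup.
From mathcomp Require Import all_solvable all_field all_character.
From mathcomp Require Import ring zify.
From mathcomp Require Import mpoly.

(* Write t = q^2.  Averaging det(1 - w) / det(1 - qw) over the signs of w, a    *)
(* negative cycle of length k contributes 2 / (1 + q^k) and a positive one 0,   *)
(* so the fake degree is (q - 1)^n / n! times the sum over s in S_n of          *)
(* chi_lam(s) f_q(s), where f_u(s) = det(1 - us) / det(1 - ts).  Since the      *)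
(* Young symmetrizer c = a b satisfies c^2 = kappa c, this sum is n! / kappa    *)
(* times the value A(u) of the class function f_u on c, at u = q.  A(u) is a    *)
(* polynomial in u, and for u = t^N it is the trace of c on N-letter words of   *)
(* length n, i.e. a combination of power sums, at x_i = t^i.                    *)
(* Let T be that combination for general x.  Multiplied by the Vandermonde      *)
(* alternant a_delta it is an eigenvector of sum_i (x_i d/dx_i)^2, because this *)
(* operator realizes the central sum of transpositions (cut and join).          *)
(* Dominance bounds the exponents occurring in T a_delta by lam + delta, and    *)
(* among those only the permutations of lam + delta have the right eigenvalue.  *)
(* Hence T a_delta = kappa a_(lam + delta), and the Vandermonde determinant     *)
(* evaluates both alternants at x_i = t^i.                                      *)

(** The inflated character does not see signs, so the sum over the signs of [w] can be done cycle by
    cycle ([sign_sum_det]). This leaves a sum over S_n of chi_lam(s) det(1 - qs) / det(1 - ts) with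
    t = q^2 ([ell_fake_degree_sum]). The character of the Specht module is the normalized trace of
    left multiplication by the Young symmetrizer c ([mxtrace_specht]), so pairing it with a class
    function evaluates that function on c ([sum_specht_class_fun]).

    Replace q by a variable u. For u = t^N the ratio of determinants is the power sum of [s] at 1,
    t, ..., t^(N-1) ([meval_power_sum]), and its value on c is kappa times a principally specialized
    Schur function: [frobenius_formula] is the bialternant formula for that function. The
    specialized alternants are Vandermonde products, which [prod_hooks_row] rewrites in hook lengths
    and contents ([hook_content_power]). Both sides being polynomials in u, infinitely many points
    t^N suffice ([hook_content_formula]), and u = q turns the content factor 1 - u t^c into 1 -
    q^(2c+1).

    The bialternant formula needs no character theory: [power_sum_vandermonde_eigen] makes the left
    side an eigenvector of a differential operator, and dominance together with the eigenvalue
    determines its support. *)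

Set Implicit Arguments.
Unset Strict Implicit.
Unset Printing Implicit Defensive.
Import Order.TTheory GRing.Theory Num.Theory.
Local Open Scope ring_scope.

(** * Determinants of weighted permutation matrices *)

Section WeightedPermutations.

Variable n : nat.
Implicit Types (s : 'S_n) (a b : 'I_n).

(** Multiplying by the transposition cuts [s a] out of its cycle and makes it a fixed point, so
    fewer points are moved. Statements about cycle products follow by this induction without an
    explicit cycle decomposition. *)
Lemma perm_bypass_ind (P : 'S_n -> Prop) :
  P 1%g -> (forall s a, s a != a -> P (tperm a (s a) * s)%g -> P s) ->
  forall s, P s.
Proof.
move=> P1 PS s; have [m] := ubnP #|[pred a | s a != a]|.
elim: m s => // m IH s; rewrite ltnS => le_s_m.
have [/existsP[a sa] | /existsPn s1] := boolP [exists a, s a != a]; last first.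
  suff -> : s = 1%g by [].
  by apply/permP=> a; rewrite perm1; apply/eqP/negPn/s1.
apply: (PS s a sa); apply: IH; apply: leq_trans le_s_m.
apply/proper_card/properP; split; last first.
  exists (s a); first by rewrite inE (inj_eq perm_inj).
  by rewrite inE permM tpermR eqxx.
apply/subsetP=> b; rewrite !inE permM.
by case: tpermP => [-> //|->|//]; rewrite ?eqxx // (inj_eq perm_inj).
Qed.

Lemma bypassE s a b : s a != a ->
  (tperm a (s a) * s)%g b =
    if b == a then s (s a) else if b == s a then s a else s b.
Proof.
move=> sa; rewrite permM; case: tpermP => [->|->|/eqP/negbTE-> /eqP/negbTE->] //.
  by rewrite eqxx.
by rewrite (negbTE sa) eqxx.
Qed.

Section Det.

Variable K : comNzRingType.
Implicit Types d : 'I_n -> K.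

(** Equals the product, over the cycles of [s], of 1 minus the product of the weights along the
    cycle. *)
Definition wperm_det d s : K :=
  \det (1%:M - \matrix_(i, j) (d i *+ (s i == j)) : 'M[K]_n).

(** The weights after [b] is cut out of the cycle of [a]: the cycle product is kept, and weight 0
    makes the new fixed point [b] contribute the factor 1. *)
Definition bypass_wt d a b (i : 'I_n) : K :=
  if i == a then d a * d b else if i == b then 0 else d i.

Lemma eq_wperm_det d d' s : d =1 d' -> wperm_det d s = wperm_det d' s.
Proof.
by move=> dd; congr (\det _); apply/matrixP=> i j; rewrite !mxE dd.
Qed.

Lemma wperm_det1 d : wperm_det d 1 = \prod_i (1 - d i).
Proof.
rewrite /wperm_det.
have -> : 1%:M - \matrix_(i, j) (d i *+ ((1%g : 'S_n) i == j))
    = diag_mx (\row_i (1 - d i)).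
  by apply/matrixP=> i j; rewrite !mxE perm1; case: eqP; rewrite ?subr0.
by rewrite det_diag; apply: eq_bigr => i _; rewrite mxE.
Qed.

Lemma det_add_row (A B : 'M[K]_n) a b x : a != b ->
  (forall i, i != a -> row i B = row i A) -> row a B = row a A + x *: row b A ->
  \det B = \det A.
Proof.
move=> ab rB raB.
pose C : 'M[K]_n := \matrix_(i, j) if i == a then A b j else A i j.
rewrite (@determinant_multilinear _ _ B A C a 1 x).
- rewrite (@determinant_alternate _ _ C a b) ?mulr0 ?addr0 ?mul1r // => j.
  by rewrite !mxE eqxx eq_sym (negbTE ab).
- rewrite raB scale1r; congr (_ + x *: _).
  by apply/rowP=> j; rewrite !mxE eqxx.
- apply/matrixP=> i j; have := rB (lift a i); rewrite eq_sym neq_lift.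
  by move=> /(_ isT)/rowP/(_ j); rewrite !mxE => ->.
- apply/matrixP=> i j; have := rB (lift a i); rewrite eq_sym neq_lift.
  by move=> /(_ isT)/rowP/(_ j); rewrite !mxE eq_sym (negbTE (neq_lift _ _)) => ->.
Qed.

(* Adding d a times row (s a) to row a, and then d (s a) times column (s a)   *)
(* to column (s (s a)), isolates the index s a.                               *)
Lemma wperm_det_bypass d s a : s a != a ->
  wperm_det d s = wperm_det (bypass_wt d a (s a)) (tperm a (s a) * s).
Proof.
move=> sa; set b := s a.
have ab : a != b by rewrite eq_sym.
have sb : s b != b by rewrite (inj_eq perm_inj).
rewrite /wperm_det; set M := 1%:M - _; set M'' := 1%:M - _.
pose M1 : 'M[K]_n := \matrix_(i, j) (M i j + if i == a then d a * M b j else 0).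
rewrite -(@det_add_row M M1 a b (d a)) //; first last.
- by apply/rowP=> j; rewrite !mxE eqxx.
- by move=> i /negbTE ia; apply/rowP=> j; rewrite !mxE ia addr0.
rewrite -(det_tr M1) -(det_tr M'').
apply/esym/(@det_add_row _ _ (s b) b (d b)); rewrite //.
  move=> j jsb; apply/rowP=> i; rewrite !mxE bypassE // -/b /bypass_wt.
  case: (eqVneq i a) => [->|ia].
    rewrite -/b (eq_sym (s b)) (negbTE jsb) mulr0n /= subr0.
    case: (b == j); case: (a == j); rewrite ?mulr1n ?mulr0n; ring.
  case: (eqVneq i b) => [->|ib].
    by rewrite mul0rn (eq_sym (s b)) (negbTE jsb) mulr0n addr0.
  by rewrite addr0.
apply/rowP=> i; rewrite !mxE bypassE // -/b /bypass_wt.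
case: (eqVneq i a) => [->|ia].
  rewrite -/b !eqxx (negbTE ab) (negbTE sb) (eq_sym b) (negbTE sb).
  by rewrite /=; ring.
case: (eqVneq i b) => [->|ib].
  rewrite !eqxx (eq_sym b) (negbTE sb) /=; ring.
have /negbTE-> : s i != b by rewrite (inj_eq perm_inj).
by rewrite /=; ring.
Qed.

End Det.
End WeightedPermutations.

(** * Words fixed by a permutation, and sums over signs *)

Section WordSums.

Variable n : nat.
Implicit Types (s : 'S_n) (a b : 'I_n).

Definition word_fixed N s (w : {ffun 'I_n -> 'I_N}) := [forall k, w (s k) == w k].

Lemma word_fixedP N s (w : {ffun 'I_n -> 'I_N}) :
  reflect (forall k, w (s k) = w k) (word_fixed s w).
Proof. exact: 'forall_eqP. Qed.

(** A word fixed by [s] repeats at [s a] the letter at [a], so the former can be forgotten. On the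
    right [s a] is a free position of weight 0, where only the letter 0 survives because 0 ^ 0 =
    1. *)
Lemma word_sum_bypass (K : comNzRingType) N s a (d : 'I_n -> K) : s a != a ->
  \sum_(w : {ffun 'I_n -> 'I_N.+1} | word_fixed s w) \prod_k d k ^+ w k =
  \sum_(w : {ffun 'I_n -> 'I_N.+1} | word_fixed (tperm a (s a) * s)%g w)
     \prod_k bypass_wt d a (s a) k ^+ w k.
Proof.
move=> sa; set b := s a; have ab : a != b by rewrite eq_sym.
rewrite [RHS](bigID (fun w : {ffun _} => w b == ord0)) /= [X in _ + X]big1 ?addr0.
  pose h (w : {ffun 'I_n -> 'I_N.+1}) := [ffun k => if k == b then ord0 else w k].
  pose h' (w : {ffun 'I_n -> 'I_N.+1}) := [ffun k => if k == b then w a else w k].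
  rewrite (reindex_onto h' h) /= => [|w /word_fixedP fw]; last first.
    apply/ffunP=> k; rewrite !ffunE (negbTE ab).
    by case: eqP => // ->; rewrite -[LHS]fw.
  have sb : (s b == b) = false by rewrite (inj_eq perm_inj) (negbTE sa).
  have skb k : k != a -> (s k == b) = false.
    by move=> /negbTE ka; rewrite (inj_eq perm_inj).
  have hh' w : (h (h' w) == w) = (w b == ord0).
    apply/eqP/eqP => [/ffunP/(_ b)|wb]; first by rewrite !ffunE eqxx => <-.
    by apply/ffunP=> k; rewrite !ffunE; case: eqP => // ->.
  apply: eq_big => [w|w /andP[_]]; rewrite hh'; last move=> /eqP wb.
    congr (_ && _); apply/word_fixedP/word_fixedP => fw k.
      rewrite bypassE // -/b; have [->|ka] := eqVneq k a.
        by have := fw b; rewrite !ffunE sb eqxx.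
      have [->//|kb] := eqVneq k b.
      by have := fw k; rewrite !ffunE skb // (negbTE kb).
    rewrite !ffunE; have [->|ka] := eqVneq k a; first by rewrite eqxx (negbTE ab).
    rewrite skb //; have [->|kb] := eqVneq k b.
      by have := fw a; rewrite bypassE // -/b eqxx.
    by have := fw k; rewrite bypassE // -/b (negbTE ka) (negbTE kb).
  rewrite (bigD1 a) //= (bigD1 b) /=; last by rewrite eq_sym.
  rewrite [in RHS](bigD1 a) //= [in RHS](bigD1 b) /=; last by rewrite eq_sym.
  rewrite /bypass_wt !ffunE !eqxx (negbTE ab) (negbTE sa) wb expr0 mul1r mulrA.
  rewrite exprMn; congr (_ * _); apply: eq_bigr => k /andP[/negbTE ka /negbTE kb].
  by rewrite ka kb ffunE kb.
move=> w /andP[_]; rewrite -val_eqE /= => wb; rewrite (bigD1 b) //= /bypass_wt eqxx (negbTE sa).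
by rewrite expr0n (negbTE wb) mul0r.
Qed.

(** Fixed words are constant on cycles, so a cycle with weight product p contributes the geometric
    sum 1 + p + ... + p^N. *)
Lemma word_sum_det (K : comNzRingType) N s (d : 'I_n -> K) :
  (\sum_(w : {ffun 'I_n -> 'I_N.+1} | word_fixed s w) \prod_k d k ^+ w k)
    * wperm_det d s = wperm_det (fun k => d k ^+ N.+1) s.
Proof.
elim/perm_bypass_ind: s d => [|s a sa IH] d.
  have fixed1 (w : {ffun 'I_n -> 'I_N.+1}) : word_fixed 1 w.
    by apply/word_fixedP=> k; rewrite perm1.
  rewrite !wperm_det1 (eq_bigl _ _ fixed1).
  rewrite -(bigA_distr_bigA (fun k (j : 'I_N.+1) => d k ^+ j)) -big_split /=.
  by apply: eq_bigr => k _; rewrite -[in RHS]opprB subrX1 mulrC -mulNr opprB.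
rewrite (word_sum_bypass _ _ sa) !(wperm_det_bypass _ sa) IH.
apply: eq_wperm_det => k; rewrite /bypass_wt.
by case: eqP => // _; [rewrite exprMn | case: eqP => //; rewrite expr0n].
Qed.

(** Closure under products keeps every cycle product away from 1; [S] contains 0 because bypassing
    creates weights 0. *)
Lemma wperm_det_neq0 (K : idomainType) (S : K -> Prop) s (d : 'I_n -> K) :
  S 0 -> (forall u v, S u -> S v -> S (u * v)) -> ~ S 1 -> (forall k, S (d k)) ->
  wperm_det d s != 0.
Proof.
move=> S0 SM S1; elim/perm_bypass_ind: s d => [|s a sa IH] d Sd.
  rewrite wperm_det1; apply/prodf_neq0 => k _; rewrite subr_eq0 eq_sym.
  by apply/eqP => dk1; apply: S1; rewrite -dk1.
rewrite (wperm_det_bypass _ sa); apply: IH => k; rewrite /bypass_wt.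
by case: ifP => _; [apply: SM | case: ifP].
Qed.

(* Averaging over the sign e of a cycle with weights X, Y:                    *)
(* ((1 - X) / (1 - Y) + (1 + X) / (1 + Y)) / 2 = (1 - X Y) / (1 - Y ^ 2).     *)
Lemma sign_sum_det (K : fieldType) (S : K -> Prop) s (x y : 'I_n -> K) :
  S 0 -> (forall u v, S u -> S v -> S (u * v)) -> ~ S 1 -> (forall k, S (y k)) ->
  \sum_(e : {ffun 'I_n -> bool})
     wperm_det (fun k => (-1) ^+ e k * x k) s
       / wperm_det (fun k => (-1) ^+ e k * y k) s =
  2 ^+ n * (wperm_det (fun k => x k * y k) s / wperm_det (fun k => y k ^+ 2) s).
Proof.
move=> S0 SM S1; elim/perm_bypass_ind: s x y => [|s a sa IH] x y Sy.
  under eq_bigr => e _ do rewrite !wperm_det1 -prodf_div.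
  rewrite !wperm_det1 -prodf_div -(bigA_distr_bigA (fun k (e : bool) =>
    (1 - (-1) ^+ e * x k) / (1 - (-1) ^+ e * y k))) /=.
  rewrite -[in 2 ^+ n](card_ord n) -prodr_const -big_split.
  apply: eq_bigr => k _ /=; rewrite big_bool /= expr0 expr1.
  have y2 : 1 - y k ^+ 2 != 0.
    rewrite subr_eq0 eq_sym expr2; apply/eqP => y2; apply: S1.
    by rewrite -y2; apply: SM.
  have y21 : 1 - y k ^+ 2 = (1 - y k) * (1 + y k) by ring.
  have := y2; rewrite y21 mulf_eq0 negb_or => /andP[y1 y1'].
  by field; rewrite y1 y1'.
set b := s a; have ab : a != b by rewrite eq_sym.
rewrite [in RHS](wperm_det_bypass _ sa) [X in _ / X](wperm_det_bypass _ sa) -/b.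
have bwM (z t : 'I_n -> K) : bypass_wt (fun k => z k * t k) a b =1
   (fun k => bypass_wt z a b k * bypass_wt t a b k).
  move=> k; rewrite /bypass_wt; case: eqP => _; first by ring.
  by case: eqP => //; rewrite mul0r.
rewrite (eq_wperm_det _ (bwM _ _)).
have -> : wperm_det (bypass_wt (fun k => y k ^+ 2) a b) (tperm a b * s) =
          wperm_det (fun k => bypass_wt y a b k ^+ 2) (tperm a b * s).
  exact: (eq_wperm_det _ (bwM _ _)).
rewrite -IH => [|k]; last first.
  by rewrite /bypass_wt; case: ifP => _; [apply: SM | case: ifP].
(* After the bypass, [a] carries the product of the signs at [a] and [b]; [h] makes that product the
   free sign at [a]. The sign at [b] is harmless, its weight being 0. *)
pose h (e : {ffun 'I_n -> bool}) := [ffun k => if k == a then e a (+) e b else e k].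
have hK : involutive h.
  move=> e; apply/ffunP=> k; rewrite !ffunE eqxx (negbTE sa).
  by case: eqP => // ->; rewrite addbK.
rewrite [RHS](reindex_inj (inv_inj hK)) /=.
apply: eq_bigr => e _; rewrite !(wperm_det_bypass _ sa) -/b.
have bwh (z : 'I_n -> K) : bypass_wt (fun k => (-1) ^+ e k * z k) a b =1
    (fun k => (-1) ^+ h e k * bypass_wt z a b k).
  move=> k; rewrite (bwM _ _ k) /bypass_wt ffunE.
  case: eqP => _; first by rewrite signr_addb.
  by case: eqP; rewrite ?mulr0.
by rewrite !(eq_wperm_det _ (bwh _)).
Qed.

End WordSums.

(** * The sum of transpositions as a differential operator *)

Section CutAndJoin.

Variables (K : comNzRingType) (n N : nat).
Local Notation word := {ffun 'I_n -> 'I_N}.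
Local Notation poly := {mpoly K[N]}.
Implicit Types (s : 'S_n) (a b : 'I_n) (w v : word) (i j : 'I_N) (p q : poly).

Definition word_mon w : poly := \prod_k 'X_(w k).

Definition letter_mult w i : nat := \sum_k (w k == i).

(** The product of the power sums p_k(X) over the cycle lengths k of [s]. *)
Definition power_sum s : poly := \sum_(w | word_fixed s w) word_mon w.

Definition euler i p : poly := 'X_i * p^`M(i).

Lemma eulerD i p q : euler i (p + q) = euler i p + euler i q.
Proof. by rewrite /euler mderivD mulrDr. Qed.

Lemma eulerM i p q : euler i (p * q) = euler i p * q + p * euler i q.
Proof. by rewrite /euler mderivM; ring. Qed.

Lemma eulerX i j : euler i 'X_j = 'X_j *+ (i == j).
Proof.
rewrite /euler mderivX mnm1E eq_sym.
case: eqP => [->|_]; last by rewrite scale0r mulr0.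
have -> : (U_(j) - U_(j))%MM = 0%MM by rewrite -{1}[U_(j)%MM]add0m addmK.
by rewrite mpolyX0 scale1r mulr1.
Qed.

Lemma euler_sum i (I : Type) (r : seq I) (Q : pred I) (F : I -> poly) :
  euler i (\sum_(x <- r | Q x) F x) = \sum_(x <- r | Q x) euler i (F x).
Proof. by rewrite /euler raddf_sum mulr_sumr. Qed.

Lemma euler_prod i (I : finType) (Q : pred I) (F : I -> poly) :
  euler i (\prod_(x | Q x) F x) =
  \sum_(x | Q x) euler i (F x) * \prod_(y | Q y && (y != x)) F y.
Proof.
have [m] := ubnP #|Q|; elim: m Q => // m IH Q; rewrite ltnS => leQm.
have [x Qx | Q0] := pickP Q; last by rewrite !big_pred0 // /euler mderivC mulr0.
rewrite (bigD1 x) //= eulerM IH; last first.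
  apply: leq_trans leQm; rewrite (cardD1 x Q) [x \in Q]Qx ltnS subset_leq_card //.
  by apply/subsetP=> y; rewrite !inE andbC.
rewrite [RHS](bigD1 x) //= mulr_sumr; congr (_ + _).
apply: eq_bigr => y /andP[Qy yx]; rewrite mulrCA; congr (_ * _).
rewrite [RHS](bigD1 x) /=; last by rewrite Qx eq_sym.
by congr (_ * _); apply: eq_bigl => z; rewrite andbAC.
Qed.

Lemma euler_word_mon i w : euler i (word_mon w) = word_mon w *+ letter_mult w i.
Proof.
rewrite /word_mon euler_prod /letter_mult -sumrMnr; apply: eq_bigr => k _.
by rewrite eulerX eq_sym mulrnAl [in RHS](bigD1 k).
Qed.

Definition join_sum s i j : poly :=
  \sum_a \sum_b \sum_w word_mon w *+
     [&& w a == i, w b == j & word_fixed (tperm a b * s)%g w].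

Lemma join_sumC s i j : join_sum s i j = join_sum s j i.
Proof.
rewrite /join_sum exchange_big /=; apply: eq_bigr => b _; apply: eq_bigr => a _.
by apply: eq_bigr => w _; rewrite tpermC andbCA.
Qed.

(** Split the words on the left by whether their letters at [a] and [b] agree. If so, [tperm a b]
    does not affect them and they are fixed by [s]; a word with letter multiplicities m_i has sum_i
    m_i (m_i - 1) such pairs of positions, which is what the Euler operators extract. The other
    words form the join sums. *)
Lemma sum_power_sum_tperm s :
  \sum_a \sum_(b | b != a) power_sum (tperm a b * s)%g =
  \sum_i (euler i (euler i (power_sum s)) - euler i (power_sum s)) +
  \sum_i \sum_(j | j != i) join_sum s i j.
Proof.
have -> : \sum_i \sum_(j | j != i) join_sum s i j =
    \sum_a \sum_(b | b != a) \sum_w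
      word_mon w *+ ((w b != w a) && word_fixed (tperm a b * s)%g w).
  rewrite /join_sum; under eq_bigr => i _ do rewrite exchange_big /=.
  rewrite exchange_big /=; apply: eq_bigr => a _.
  under eq_bigr => i _ do rewrite exchange_big /=.
  rewrite exchange_big [RHS]big_mkcond; apply: eq_bigr => b _ /=.
  have [->|ba] /= := eqVneq b a.
    rewrite big1 // => i _; rewrite big1 // => j ji; rewrite big1 // => w _.
    by case: eqP => //= ->; rewrite eq_sym (negbTE ji).
  under eq_bigr => i _ do rewrite exchange_big /=.
  rewrite exchange_big /=; apply: eq_bigr => w _.
  rewrite (bigD1 (w a)) //= [X in _ + X]big1 ?addr0 => [|i iw]; last first.
    by rewrite big1 // => j _; rewrite eq_sym (negbTE iw).
  rewrite eqxx /=; have [wba|wba] /= := eqVneq (w b) (w a).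
    by rewrite big1 // => j; rewrite wba eq_sym => /negbTE->.
  rewrite (bigD1 (w b)) //= eqxx big1 ?addr0 // => j /andP[_ jw].
  by rewrite eq_sym (negbTE jw).
under eq_bigr => a _ do under eq_bigr => b _ do rewrite /power_sum big_mkcond /=.
apply/eqP; rewrite -subr_eq -sumrB; apply/eqP.
transitivity (\sum_a \sum_(b | b != a) \sum_(w | word_fixed s w)
    word_mon w *+ (w b == w a)).
  apply: eq_bigr => a _; rewrite -sumrB; apply: eq_bigr => b _.
  rewrite -sumrB [RHS]big_mkcond; apply: eq_bigr => w _ /=.
  have [wba|_] /= := eqVneq (w b) (w a); last first.
    by case: ifP => _; rewrite ?subrr ?if_same.
  rewrite mulr0n subr0; congr (if _ then _ else _).
  have tw k : w (tperm a b k) = w k by case: tpermP => // ->.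
  apply/word_fixedP/word_fixedP => f k; last by rewrite permM f tw.
  by rewrite -[LHS]tw -(tw k) -(f (tperm a b k)) permM tpermK tw.
rewrite /power_sum; under [RHS]eq_bigr => i _ do rewrite !euler_sum -sumrB.
under [LHS]eq_bigr => a _ do rewrite exchange_big /=.
rewrite exchange_big [RHS]exchange_big; apply: eq_bigr => w _ /=.
under [LHS]eq_bigr => a _ do rewrite sumrMnr.
rewrite sumrMnr.
have eulerMn i p m : euler i (p *+ m) = euler i p *+ m.
  by rewrite /euler mderivMn mulrnAr.
under [RHS]eq_bigr => i _ do rewrite !(eulerMn, euler_word_mon).
rewrite sumrB; apply/eqP; rewrite eq_sym subr_eq; apply/eqP.
under [LHS]eq_bigr => i _ do rewrite -mulrnA.
rewrite !sumrMnr -mulrnDr; congr (_ *+ _).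
rewrite /letter_mult.
transitivity (\sum_a \sum_b (w b == w a))%N.
  under eq_bigr => i _ do rewrite big_distrlr /=.
  rewrite exchange_big /=; apply: eq_bigr => a _.
  rewrite exchange_big /=; apply: eq_bigr => b _.
  rewrite (bigD1 (w a)) //= eqxx mul1n big1 ?addn0 // => i iw.
  by rewrite eq_sym (negbTE iw).
rewrite [X in (_ + X)%N]exchange_big -big_split; apply: eq_bigr => a _ /=.
rewrite (bigD1 a) //= eqxx addnC; congr (_ + _)%N.
by rewrite (bigD1 (w a)) //= eqxx big1 ?addn0 // => i iw; rewrite eq_sym (negbTE iw).
Qed.

Definition word_upd w a i : word := [ffun k => if k == a then i else w k].

Lemma word_mon_upd w a i : 'X_(w a) * word_mon (word_upd w a i) = 'X_i * word_mon w.
Proof.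
rewrite /word_mon [in LHS](bigD1 a) // [in RHS](bigD1 a) //= ffunE eqxx mulrCA.
congr (_ * (_ * _)); apply: eq_bigr => k /negbTE ka; by rewrite ffunE ka.
Qed.

Lemma word_upd_id w a i : w a = i -> word_upd w a i = w.
Proof. by move=> wa; apply/ffunP=> k; rewrite ffunE; case: eqP => // ->. Qed.

Lemma word_upd_upd w a i j : word_upd (word_upd w a i) a j = word_upd w a j.
Proof. by apply/ffunP=> k; rewrite !ffunE; case: eqP. Qed.

Lemma sum_word_upd (A B : pred word) a i j :
  (forall v, A v -> v a = j) -> (forall w, B w -> w a = i) ->
  (forall w, w a = i -> A (word_upd w a j) = B w) ->
  'X_i * (\sum_v word_mon v *+ A v) = 'X_j * (\sum_w word_mon w *+ B w).
Proof.
move=> Aj Bi AB; rewrite !mulr_sumr.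
have sumE (C : pred word) (x : poly) :
    \sum_v x * (word_mon v *+ C v) = \sum_(v | C v) x * word_mon v.
  by rewrite [RHS]big_mkcond; apply: eq_bigr => v _; case: (C v); rewrite ?mulr0.
rewrite !sumE (reindex_onto (fun w => word_upd w a j) (fun v => word_upd v a i)) /=.
  apply: eq_big => [w|w /andP[_ /eqP/ffunP/(_ a)]].
    rewrite word_upd_upd.
    apply/andP/idP => [[Aw /eqP wa]|Bw].
      by rewrite -AB // -wa ffunE eqxx.
    by rewrite (word_upd_id (Bi w Bw)) AB ?Bi.
  by rewrite !ffunE eqxx => iE; rewrite -(word_mon_upd w a) -iE.
by move=> v Av; rewrite word_upd_upd word_upd_id // Aj.
Qed.

Lemma join_sumE s i j : i != j ->
  ('X_i - 'X_j) * join_sum s i j =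
  'X_j * euler i (power_sum s) - 'X_i * euler j (power_sum s).
Proof.
move=> ij.
(* [Z] is computed twice. Moving its first position from [a] to [s a] gives [ZR]; replacing the
   letter [j] at [a] by [i] gives [ZL], at the price of exchanging factors 'X_j and 'X_i. In both,
   the diagonal pairs supply the Euler term, and eliminating [Z] proves the identity. *)
pose cond a b v := [forall k, word_upd v a i (s k) == word_upd v b i k].
pose Z : poly := \sum_a \sum_b \sum_v word_mon v *+ [&& v a == j, v b == j & cond a b v].
have sumP l : euler l (power_sum s) =
    \sum_a \sum_w word_mon w *+ ((w a == l) && word_fixed s w).
  rewrite /power_sum euler_sum exchange_big /= [LHS]big_mkcond /=.
  apply: eq_bigr => w _; rewrite euler_word_mon /letter_mult -sumrMnr.
  case: ifP => fw; last by rewrite big1 // => a _; rewrite andbF.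
  by apply: eq_bigr => a _; rewrite andbT.
have ZR : Z = join_sum s i j + euler j (power_sum s).
  rewrite /Z (reindex_inj (@perm_inj _ s)) /= sumP /join_sum -big_split /=.
  apply: eq_bigr => a _.
  rewrite (bigD1 a) //= [in RHS](bigD1 a) //= [X in _ = X + _ + _]big1 => [|w _].
    rewrite add0r addrC; congr (_ + _).
      apply: eq_bigr => b ba; apply: eq_bigr => v _; congr (_ *+ _); congr nat_of_bool.
      have sba : s b != s a by rewrite (inj_eq perm_inj).
      have tpermN k : k != a -> k != b -> tperm a b k = k by rewrite !(eq_sym k); apply: tpermD.
      apply/and3P/and3P => [[/eqP vsa /eqP vb /forallP c]|[/eqP va /eqP vb /word_fixedP f]].
        have va : v a = i.
          by have /eqP := c a; rewrite !ffunE eqxx eq_sym (negbTE ba).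
        rewrite va vb !eqxx; split=> //; apply/word_fixedP=> k; rewrite permM.
        case: tpermP => [->|->|/eqP ka /eqP kb].
        - by have /eqP := c b; rewrite !ffunE eqxx (negbTE sba) va.
        - by rewrite vsa.
        have /eqP := c k; rewrite !ffunE (negbTE kb) (inj_eq perm_inj).
        by rewrite (negbTE ka).
      have vsa : v (s a) = j by rewrite -vb -(f b) permM tpermR.
      rewrite vsa vb !eqxx; split=> //; apply/forallP=> k; rewrite !ffunE.
      rewrite (inj_eq perm_inj); have [->|ka] := eqVneq k a.
        by case: eqVneq ba => // _ _; rewrite va.
      have [->|kb] := eqVneq k b; first by rewrite -va -(f a) permM tpermL.
      by rewrite -(f k) permM tpermN.
    apply: eq_bigr => v _; congr (_ *+ _); congr nat_of_bool.
    apply/and3P/andP => [[/eqP vsa /eqP va /forallP c]|[/eqP va /word_fixedP f]].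
      rewrite va eqxx; split=> //; apply/word_fixedP=> k.
      have /eqP := c k; rewrite !ffunE (inj_eq perm_inj).
      by case: eqP => // -> _; rewrite vsa.
    rewrite f va eqxx; split=> //; apply/forallP=> k.
    by rewrite !ffunE (inj_eq perm_inj) f.
  by case: eqP => //= ->; rewrite (negbTE ij).
have ZL : 'X_i * Z = 'X_j * (join_sum s i j + euler i (power_sum s)).
  rewrite sumP /Z /join_sum -big_split !mulr_sumr /=; apply: eq_bigr => a _.
  rewrite (bigD1 a) //= [in RHS](bigD1 a) //= [X in _ = _ * (X + _ + _)]big1 => [|w _].
    rewrite add0r addrC !mulrDr; congr (_ + _).
      rewrite !mulr_sumr; apply: eq_bigr => b ba.
      apply: (sum_word_upd (a := a)) => [v /andP[/eqP//]|w /andP[/eqP//]|w wa].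
      rewrite !ffunE !eqxx (negbTE ba) wa eqxx /=.
      have [wb /=|//] := eqVneq (w b) j; rewrite /cond word_upd_upd word_upd_id //.
      have updE k : word_upd (word_upd w a j) b i k = w (tperm a b k).
        rewrite !ffunE; case: tpermP => [->|->|/eqP/negbTE-> /eqP/negbTE->] //.
          by rewrite eq_sym (negbTE ba) eqxx.
        by rewrite eqxx.
      apply/'forall_eqP/word_fixedP => c k.
        by have := c (tperm a b k); rewrite updE tpermK permM.
      by rewrite updE -[w (tperm a b k)]c permM tpermK.
    apply: (sum_word_upd (a := a)) => [v /andP[/eqP//]|w /andP[/eqP//]|w wa].
    rewrite !ffunE !eqxx wa eqxx /= /cond.
    by rewrite word_upd_upd word_upd_id.
  by case: eqP => //= ->; rewrite (negbTE ij).
have := ZL; rewrite ZR mulrDr (mulrDr 'X_j) mulrBl => /eqP.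
rewrite addrC -subr_eq => /eqP <-; ring.
Qed.

End CutAndJoin.

(** * The second-order Euler operator and the Vandermonde product *)

Section VandermondeEigen.

Variables (K : comNzRingType) (n N : nat).
Implicit Types (s : 'S_n) (i j : 'I_N).

Lemma sum_letter_mult (w : {ffun 'I_n -> 'I_N}) : (\sum_i letter_mult w i)%N = n.
Proof.
rewrite exchange_big /= -[RHS](card_ord n) -sum1_card; apply: eq_bigr => k _.
by rewrite (bigD1 (w k)) //= eqxx big1 ?addn0 // => i iw; rewrite eq_sym (negbTE iw).
Qed.

Lemma sum_euler_power_sum s :
  \sum_i euler i (power_sum K N s) = power_sum K N s *+ n.
Proof.
rewrite /power_sum; under eq_bigr => i _ do rewrite euler_sum.
rewrite exchange_big -sumrMnl; apply: eq_bigr => w _ /=.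
under eq_bigr => i _ do rewrite euler_word_mon.
by rewrite sumrMnr sum_letter_mult.
Qed.

Lemma sum_lt_pairs (V : nmodType) (F : 'I_N -> 'I_N -> V) :
  \sum_(p : 'I_N * 'I_N | (p.1 < p.2)%N) (F p.1 p.2 + F p.2 p.1) =
  \sum_i \sum_(j | j != i) F i j.
Proof.
have pairE (G : 'I_N -> 'I_N -> V) : \sum_(p : 'I_N * 'I_N | (p.1 < p.2)%N) G p.1 p.2 =
    \sum_(i : 'I_N) \sum_(j : 'I_N | (i < j)%N) G i j.
  by rewrite pair_big_dep.
rewrite big_split pairE (pairE (fun i j => F j i)) /=.
have -> : \sum_(i : 'I_N) \sum_(j : 'I_N | (i < j)%N) F j i = \sum_(i : 'I_N) \sum_(j : 'I_N | (j < i)%N) F i j.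
  by rewrite (exchange_big_dep xpredT).
rewrite -big_split; apply: eq_bigr => i _ /=.
rewrite [RHS](bigID (fun j : 'I_N => (i < j)%N)) /=.
by congr (_ + _); apply: eq_bigl => j; rewrite -val_eqE /=; case: ltngtP.
Qed.

Lemma sum_euler2M (p q : {mpoly K[N]}) :
  \sum_i euler i (euler i (p * q)) =
  (\sum_i euler i (euler i p)) * q + (\sum_i euler i p * euler i q) *+ 2
    + p * \sum_i euler i (euler i q).
Proof.
rewrite mulr_suml mulr_sumr -sumrMnl -!big_split; apply: eq_bigr => i _ /=.
by rewrite !(eulerM, eulerD); ring.
Qed.

Definition vandermonde_prod : {mpoly K[N]} :=
  \prod_(p : 'I_N * 'I_N | (p.1 < p.2)%N) ('X_p.1 - 'X_p.2).

(** Write E_i for [euler i] and P for the power sum. The factor of the pair i < j contributes (X_i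
    E_i P - X_j E_j P) / (X_i - X_j), which by [join_sumE] is the polynomial J + E_i P + E_j P with
    J the join sum. The Euler terms add up by homogeneity of degree [n]. *)
Lemma sum_euler_vandermonde s :
  (\sum_i euler i (power_sum K N s) * euler i vandermonde_prod) *+ 2 =
  (\sum_i \sum_(j | j != i) join_sum K s i j + power_sum K N s *+ (2 * n * N.-1))
     * vandermonde_prod.
Proof.
set P := power_sum K N s; set W := vandermonde_prod.
have -> : \sum_i euler i P * euler i W = \sum_(p : 'I_N * 'I_N | (p.1 < p.2)%N)
    (join_sum K s p.1 p.2 + (euler p.1 P + euler p.2 P)) * W.
  under eq_bigr => i _ do rewrite euler_prod mulr_sumr.
  rewrite exchange_big; apply: eq_bigr => p ltp /=.
  have np : p.1 != p.2 by rewrite -val_eqE neq_ltn ltp.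
  rewrite /W /vandermonde_prod (bigD1 p ltp) /=.
  under eq_bigr => i _ do rewrite mulrA.
  rewrite -mulr_suml [RHS]mulrA; congr (_ * _).
  have eB i : euler i ('X_p.1 - 'X_p.2 : {mpoly K[N]}) =
       'X_p.1 *+ (i == p.1) - 'X_p.2 *+ (i == p.2).
    by rewrite -!eulerX /euler mderivB mulrBr.
  have -> : \sum_i euler i P * euler i ('X_p.1 - 'X_p.2) =
      euler p.1 P * 'X_p.1 - euler p.2 P * 'X_p.2.
    under eq_bigr => i _ do rewrite eB mulrBr.
    have sumE (k : 'I_N) (x : {mpoly K[N]}) :
        \sum_i euler i P * (x *+ (i == k)) = euler k P * x.
      rewrite (bigD1 k) //= eqxx big1 ?addr0 // => i /negbTE->.
      by rewrite mulr0.
    by rewrite sumrB !sumE.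
  have := join_sumE K s np; rewrite -/P => JE.
  rewrite mulrDl [join_sum _ _ _ _ * _]mulrC JE; ring.
rewrite -mulr_suml -mulrnAl; congr (_ * _).
rewrite big_split mulrnDl; congr (_ + _).
  rewrite -sum_lt_pairs -sumrMnl; apply: eq_bigr => p _.
  by rewrite [in RHS](join_sumC _ _ p.2) mulr2n.
rewrite (sum_lt_pairs (fun i _ => euler i P)).
under eq_bigr => i _ do rewrite sumr_const cardC1 card_ord.
by rewrite sumrMnl sum_euler_power_sum -!mulrnA; congr (_ *+ _); ring.
Qed.

(* Multiplication by the class of transpositions is, up to a scalar, the      *)
(* conjugate by the Vandermonde product of the operator sum_i (X_i d/dX_i)^2. *)
Lemma power_sum_vandermonde_eigen s (c : K) :
  let W := c *: vandermonde_prod in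
  \sum_i euler i (euler i (power_sum K N s * W)) =
  (\sum_a \sum_(b | b != a) power_sum K N (tperm a b * s)%g
     + power_sum K N s *+ (n + 2 * n * N.-1)) * W
  + power_sum K N s * \sum_i euler i (euler i W).
Proof.
move=> W; set P := power_sum K N s.
have eW i : euler i W = c *: euler i vandermonde_prod.
  by rewrite /euler mderivZ scalerAr.
rewrite sum_euler2M; congr (_ + _).
have -> : (\sum_i euler i P * euler i W) *+ 2 =
    (\sum_i \sum_(j | j != i) join_sum K s i j + P *+ (2 * n * N.-1)) * W.
  rewrite -scalerAr -sum_euler_vandermonde -scalerMnr scaler_sumr; congr (_ *+ _).
  apply: eq_bigr => i _. rewrite eW. by rewrite -scalerAr.
rewrite sum_power_sum_tperm -mulrDl; congr (_ * _).
rewrite sumrB sum_euler_power_sum -/P mulrnDr; ring.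
Qed.


End VandermondeEigen.

(** * Young symmetrizers *)

Section RowsColumns.

Variables (n : nat) (lam : seq nat).
Hypothesis lamP : is_partition n lam.
Implicit Types (k l : 'I_n) (s r c : 'S_n).

Local Notation row := (reshape_index lam).
Local Notation col := (reshape_offset lam).
Local Notation R := (row_stab n lam).
Local Notation C := (col_stab n lam).

Let sumn_lam : sumn lam = n.
Proof. by case/and3P: lamP => _ _ /eqP. Qed.

Lemma nth_part_le i j : (i <= j)%N -> (nth 0 lam j <= nth 0 lam i)%N.
Proof.
case/and3P: lamP => srt _ _ ij.
have [jl|jl] := ltnP j (size lam); last by rewrite nth_default.
have geq_trans : transitive geq by move=> a b d ab bd; apply: leq_trans bd ab.
apply: (sorted_leq_nth geq_trans leqnn 0%N srt); rewrite ?inE //.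
exact: leq_ltn_trans jl.
Qed.

Lemma row_lt k : (row k < size lam)%N.
Proof. by apply: reshape_indexP; rewrite sumn_lam. Qed.

Lemma col_lt k : (col k < nth 0 lam (row k))%N.
Proof. by apply: reshape_offsetP; rewrite sumn_lam. Qed.

Lemma row_col_inj k l : row k = row l -> col k = col l -> k = l.
Proof.
by move=> rkl ckl; apply: val_inj; rewrite /= -(reshape_indexK lam k) rkl ckl reshape_indexK.
Qed.

Lemma box_exists i j : (j < nth 0 lam i)%N -> {k : 'I_n | row k = i /\ col k = j}.
Proof.
move=> ji; have lt_n : (flatten_index lam i j < n)%N by rewrite -sumn_lam flatten_indexP.
by exists (Ordinal lt_n); rewrite /= flatten_indexKl ?flatten_indexKr.
Qed.

Lemma row_stabP s : reflect (forall k, row (s k) = row k) (s \in R).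
Proof. by rewrite inE; apply: 'forall_eqP. Qed.

Lemma col_stabP s : reflect (forall k, col (s k) = col k) (s \in C).
Proof. by rewrite inE; apply: 'forall_eqP. Qed.

Lemma row_stab_group_set : group_set R.
Proof.
apply/group_setP; split=> [|s r /row_stabP sR /row_stabP rR].
  by apply/row_stabP=> k; rewrite perm1.
by apply/row_stabP=> k; rewrite permM rR.
Qed.
Canonical row_stab_group := Group row_stab_group_set.

Lemma col_stab_group_set : group_set C.
Proof.
apply/group_setP; split=> [|s r /col_stabP sC /col_stabP rC].
  by apply/col_stabP=> k; rewrite perm1.
by apply/col_stabP=> k; rewrite permM rC.
Qed.
Canonical col_stab_group := Group col_stab_group_set.

Lemma row_col_stab_unique r r' c c' : r \in R -> r' \in R -> c \in C -> c' \in C ->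
  (r * c = r' * c')%g -> r = r' /\ c = c'.
Proof.
move=> rR r'R cC c'C rc.
have E : (r'^-1 * r = c' * c^-1)%g by apply: (mulgI r'); apply: (mulIg c); rewrite mulKVg mulgA mulgKV.
have RC s : s \in R -> s \in C -> s = 1%g.
  move=> /row_stabP sR /col_stabP sC; apply/permP=> k; rewrite perm1.
  exact: row_col_inj.
have e1 : (r'^-1 * r = 1)%g by apply: RC; [|rewrite E]; rewrite groupM ?groupV.
split; first by apply: (mulgI (r'^-1)%g); rewrite e1 mulVg.
by apply/esym/(mulIg (c^-1)%g); rewrite mulgV -E.
Qed.

Lemma tperm_row k l : row k = row l -> tperm k l \in R.
Proof. by move=> kl; apply/row_stabP=> a; case: tpermP => // ->. Qed.

Lemma tperm_col k l : col k = col l -> tperm k l \in C.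
Proof. by move=> kl; apply/col_stabP=> a; case: tpermP => // ->. Qed.

Definition col_distinct (f : 'I_n -> nat) :=
  [forall k : 'I_n, forall l : 'I_n, (col k == col l) && (f k == f l) ==> (k == l)].

Lemma col_distinctP f :
  reflect (forall k l : 'I_n, col k = col l -> f k = f l -> k = l) (col_distinct f).
Proof.
apply: (iffP forallP) => [H k l ckl fkl|H k].
  by have /forallP/(_ l) := H k; rewrite ckl fkl !eqxx => /eqP.
by apply/forallP=> l; apply/implyP=> /andP[/eqP ckl /eqP fkl]; apply/eqP/H.
Qed.

(* g k is the box of the column of k whose row is the rank of f k among the   *)
(* entries of f in that column.                                               *)
Lemma col_sort (f : 'I_n -> nat) : col_distinct f ->
  exists2 g : 'S_n, g \in C & forall k, (row (g k) <= f k)%N.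
Proof.
move=> /col_distinctP fP.
pose below k := [set l : 'I_n | (col l == col k) && (f l < f k)%N].
have below_le k : (#|below k| <= f k)%N.
  rewrite cardE -(size_map f) -[X in (_ <= X)%N](size_iota 0).
  apply: uniq_leq_size => [|x /mapP[l]].
    rewrite map_inj_in_uniq ?enum_uniq // => a b.
    by rewrite !mem_enum !inE => /andP[/eqP ca _] /andP[/eqP cb _]; apply: fP; rewrite ca.
  by rewrite mem_enum inE => /andP[_ lt_f] ->; rewrite mem_iota.
(* Without that box the column of [k] would have at most [#|below k|] boxes, although [below k]
   omits [k] itself. *)
have box k : (col k < nth 0 lam #|below k|)%N.
  rewrite ltnNge; apply/negP=> le_col.
  have : (#|[set l : 'I_n | col l == col k]| <= #|below k|)%N.
    rewrite cardE -(size_map (fun l : 'I_n => row l)) -[X in (_ <= X)%N](size_iota 0).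
    apply: uniq_leq_size => [|x /mapP[l]].
      rewrite map_inj_in_uniq ?enum_uniq // => a b.
      rewrite !mem_enum !inE => /eqP ca /eqP cb rab.
      by apply: row_col_inj; rewrite ?ca.
    rewrite mem_enum inE => /eqP cl ->; rewrite mem_iota leq0n add0n ltnNge.
    apply/negP=> /nth_part_le le2; have := col_lt l; rewrite cl.
    by move=> /leq_trans/(_ le2); rewrite ltnNge le_col.
  rewrite leqNgt => /negP; apply; apply/proper_card/properP; split.
    by apply/subsetP=> l; rewrite !inE => /andP[].
  by exists k; rewrite !inE eqxx // ltnn.
pose g0 k := sval (box_exists (box k)).
have rg k : row (g0 k) = #|below k| by rewrite /g0; case: box_exists => ? [].
have cg k : col (g0 k) = col k by rewrite /g0; case: box_exists => ? [].
have ginj : injective g0.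
  move=> k l kl; have ckl : col k = col l by rewrite -cg kl cg.
  have lt_card (a b : 'I_n) : col a = col b -> (f a < f b)%N -> (#|below a| < #|below b|)%N.
    move=> cab fab; apply/proper_card/properP; split.
      apply/subsetP=> i; rewrite !inE cab => /andP[-> /=] /ltn_trans; exact.
    by exists a; rewrite !inE ?cab ?eqxx ?fab // ltnn.
  have := rg k; rewrite kl rg; have [fkl|flk|fkl _] := ltngtP (f k) (f l).
  - by have := lt_card _ _ ckl fkl => /[swap] ->; rewrite ltnn.
  - by have := lt_card _ _ (esym ckl) flk => /[swap] ->; rewrite ltnn.
  exact: fP.
exists (perm ginj); first by apply/col_stabP=> k; rewrite permE.
by move=> k; rewrite permE rg.
Qed.

(** [col_sort] gives an inequality at each box, and the bound on the sums leaves no room for a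
    strict one. *)
Lemma col_sort_eq (f : 'I_n -> nat) : col_distinct f ->
  (\sum_k f k <= \sum_(k < n) row k)%N ->
  exists2 g : 'S_n, g \in C & forall k, f k = row (g k).
Proof.
move=> /col_sort[g gC leg] sum_le; exists g => // k.
apply/eqP; rewrite eqn_leq leg andbT leqNgt; apply/negP=> ltk.
move: sum_le; rewrite leqNgt => /negP; apply.
rewrite (reindex_inj (@perm_inj _ g)) /= (bigD1 k) //= [X in (_ < X)%N](bigD1 k) //=.
by rewrite -addSn leq_add // leq_sum.
Qed.

Lemma card_row m : #|[set k : 'I_n | row k == m]| = nth 0 lam m.
Proof.
pose b (j : 'I_(nth 0 lam m)) := sval (box_exists (ltn_ord j)).
have bP j : row (b j) = m /\ col (b j) = j by rewrite /b; case: box_exists.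
have binj : injective b by move=> i j ij; apply: val_inj; rewrite /= -(bP i).2 ij (bP j).2.
rewrite -[RHS]card_ord -cardsT -(card_imset _ binj); apply: eq_card => k.
rewrite inE; apply/eqP/imsetP => [rk|[j _ ->]]; last by case: (bP j).
have ck : (col k < nth 0 lam m)%N by rewrite -rk col_lt.
exists (Ordinal ck) => //; apply: row_col_inj; first by rewrite (bP _).1.
by rewrite (bP _).2.
Qed.

Lemma card_row_lt m : #|[set k : 'I_n | (row k < m)%N]| = (\sum_(i < m) nth 0 lam i)%N.
Proof.
elim: m => [|m IH]; first by rewrite big_ord0; apply: eq_card0 => k; rewrite inE.
rewrite big_ord_recr /= -IH.
have -> : [set k : 'I_n | (row k < m.+1)%N] =
    [set k : 'I_n | (row k < m)%N] :|: [set k : 'I_n | row k == m].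
  by apply/setP=> k; rewrite !inE ltnS leq_eqVlt orbC.
rewrite cardsU [X in (_ - X)%N](_ : _ = 0%N) ?subn0; last first.
  by apply: eq_card0 => k; rewrite !inE; case: ltngtP.
by rewrite card_row.
Qed.

(** The source of dominance: the permutation from [col_sort] moves the positions with entries below
    [m] into the first [m] rows. *)
Lemma col_distinct_dominated (f : 'I_n -> nat) m : col_distinct f ->
  (#|[set k | f k < m]| <= \sum_(i < m) nth 0 lam i)%N.
Proof.
move=> /col_sort[g _ leg]; rewrite -card_row_lt.
rewrite -(card_imset _ (@perm_inj _ g)) subset_leq_card //.
by apply/subsetP=> _ /imsetP[k + ->]; rewrite !inE; apply: leq_ltn_trans.
Qed.

End RowsColumns.

(** * The Young symmetrizer as a quasi-idempotent, and its action on words *)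

Section YoungSums.

Variables (n : nat) (lam : seq nat).
Hypothesis lamP : is_partition n lam.
Variable K : fieldType.
Hypothesis K2 : 2%:R != 0 :> K.
Implicit Types (k l : 'I_n) (s r c x : 'S_n).

Local Notation row := (reshape_index lam).
Local Notation col := (reshape_offset lam).
Local Notation R := (row_stab n lam).
Local Notation C := (col_stab n lam).

(** The linear extension of [phi] to the group algebra, evaluated at the Young symmetrizer;
    identities for the symmetrizer thus apply with values in any module. *)
Definition young_sum (V : lmodType K) (phi : 'S_n -> V) : V :=
  \sum_(r in R) \sum_(c in C) ((-1) ^+ odd_perm c : K) *: phi (r * c)%g.

Definition young_coef x : K :=
  \sum_(r in R) \sum_(c in C) (-1) ^+ odd_perm c *+ (r * c == x)%g.

(** The constant kappa with c^2 = kappa c ([young_sum_idem]), in the form in which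
    [young_sum_sandwich] and [young_sum_content_shape] produce it. *)
Definition young_scalar : K :=
  \sum_(r in R) \sum_(c in C) (-1) ^+ odd_perm c * young_coef (c * r)%g.

Lemma young_coef_mul r c : r \in R -> c \in C ->
  young_coef (r * c)%g = (-1) ^+ odd_perm c.
Proof.
move=> rR cC; rewrite /young_coef (bigD1 r) //= (bigD1 c) //= eqxx mulr1n.
rewrite !big1 ?addr0 // => [r' /andP[r'R r'r]|c' /andP[c'C c'c]].
  apply: big1 => c' c'C; case: eqP => // rc.
  by have [E _] := row_col_stab_unique r'R rR c'C cC rc; rewrite E eqxx in r'r.
by case: eqP => // /mulgI E; rewrite E eqxx in c'c.
Qed.

Lemma young_coef_neq0 x : young_coef x != 0 -> exists r c, [/\ r \in R, c \in C & x = (r * c)%g].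
Proof.
move=> nz; have [/existsP[r /existsP[c /and3P[rR cC /eqP xE]]]|no] :=
  boolP [exists r : 'S_n, exists c : 'S_n, [&& r \in R, c \in C & x == r * c]%g].
  by exists r, c.
case/eqP: nz; apply: big1 => r rR; apply: big1 => c cC; case: eqP => // E.
by case/negP: no; apply/existsP; exists r; apply/existsP; exists c; rewrite rR cC E eqxx.
Qed.

Section Values.

Variable V : lmodType K.
Implicit Types phi : 'S_n -> V.

Lemma eq_opp_eq0 (v : V) : v = - v -> v = 0.
Proof.
move=> vN; have /eqP : 2%:R *: v = 0 by rewrite scaler_nat mulr2n {1}vN addNr.
by rewrite scaler_eq0 (negbTE K2) => /eqP.
Qed.

(* Von Neumann's lemma: either x = r c, or some transposition t in C is       *)
(* conjugated by x to a transposition in R, and then t cancels the sum.       *)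
Lemma young_sum_sandwich phi x :
  \sum_(r in R) \sum_(c in C) ((-1) ^+ odd_perm c : K) *: phi (r * x * c)%g =
  young_coef x *: young_sum phi.
Proof.
have [dist|] := boolP (col_distinct lam (fun k => row (x^-1 k)%g)).
  have [|g gC gE] := col_sort_eq lamP dist.
    by rewrite [X in (_ <= X)%N](reindex_inj (@perm_inj _ x^-1%g)).
  have rR : (x * g)%g \in R.
    by apply/row_stabP=> k; rewrite permM -gE permK.
  have xE : x = ((x * g) * g^-1)%g by rewrite mulgK.
  rewrite [in RHS]xE young_coef_mul ?groupV // odd_permV.
  rewrite [RHS]scaler_sumr (reindex_inj (mulIg (x * g)^-1%g)) /=.
  apply: eq_big => [r|r _]; first by rewrite groupMr ?groupV.
  rewrite scaler_sumr (reindex_inj (mulgI g)) /=.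
  apply: eq_big => [c|c _]; first by rewrite groupMl.
  rewrite odd_permM signr_addb scalerA; congr (_ *: phi _).
  by rewrite invMg !mulgA !(mulgKV, mulgK).
move=> /col_distinctP; move=> dist.
have [k [l [ckl rkl kl]]] : exists k l : 'I_n,
    [/\ col k = col l, row (x^-1 k)%g = row (x^-1 l)%g & k != l].
  have [/existsP[k /existsP[l /and3P[/eqP ? /eqP ? ?]]]|no] := boolP [exists k : 'I_n,
    exists l : 'I_n, [&& col k == col l, row (x^-1 k)%g == row (x^-1 l)%g & k != l]].
    by exists k, l.
  case: dist => k l ckl rkl; apply/eqP; apply: contraNT no => kl.
  by apply/existsP; exists k; apply/existsP; exists l; rewrite ckl rkl kl !eqxx.
have -> : young_coef x = 0.
  apply/eqP; apply: contraNT kl => /young_coef_neq0[r [c [rR cC xE]]].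
  have rowE (a : 'I_n) : row (x^-1 a)%g = row (c^-1 a)%g.
    by rewrite xE invMg permM; have /row_stabP := groupVr rR.
  have /col_stabP cVC := groupVr cC.
  apply/eqP/(@perm_inj _ c^-1%g)/(@row_col_inj _ lam); first by rewrite -!rowE.
  by rewrite !cVC.
rewrite scale0r; apply: eq_opp_eq0; rewrite -[RHS]sumrN.
have tC := tperm_col ckl; have tR := tperm_row rkl.
rewrite (reindex_inj (mulIg (tperm (x^-1 k) (x^-1 l))%g)) /=.
apply: eq_big => [r|r _]; first by rewrite groupMr.
rewrite -[RHS]sumrN (reindex_inj (mulgI (tperm k l))) /=.
apply: eq_big => [c|c _]; first by rewrite groupMl.
rewrite odd_permM odd_tperm kl signr_addb expr1 mulN1r scaleNr; congr (- (_ *: phi _)).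
by rewrite -tpermJ conjgE invgK !mulgA mulgKV -(mulgA _ (tperm k l) (tperm k l)) tperm2 mulg1.
Qed.

(** In c c = a b a b the inner product b a is expanded, and [young_sum_sandwich] absorbs each of its
    terms. *)
Lemma young_sum_idem phi :
  young_sum (fun x => young_sum (fun y => phi (x * y)%g)) = young_scalar *: young_sum phi.
Proof.
rewrite /young_scalar [in RHS]exchange_big [RHS]scaler_suml.
transitivity (\sum_(c in C) \sum_(r' in R) ((-1) ^+ odd_perm c : K) *:
   \sum_(r in R) \sum_(c' in C) ((-1) ^+ odd_perm c' : K) *: phi (r * (c * r') * c')%g).
  rewrite /young_sum; under eq_bigr => r _ do under eq_bigr => c _ do rewrite scaler_sumr.
  rewrite exchange_big /=; apply: eq_bigr => c _.
  rewrite exchange_big /=; apply: eq_bigr => r' _.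
  rewrite scaler_sumr; apply: eq_bigr => r _; congr (_ *: _).
  by apply: eq_bigr => c' _; rewrite !mulgA.
apply: eq_bigr => c _; rewrite scaler_suml; apply: eq_bigr => r' _.
by rewrite young_sum_sandwich scalerA.
Qed.

(** The sum of transpositions is central, so it can be moved between the row and the column factor,
    where [young_sum_sandwich] applies to each transposition. *)
Lemma young_sum_tperm phi :
  \sum_(a : 'I_n) \sum_(b | b != a) young_sum (fun s => phi (tperm a b * s)%g) =
  (\sum_(a : 'I_n) \sum_(b | b != a) young_coef (tperm a b)) *: young_sum phi.
Proof.
rewrite scaler_suml; under [RHS]eq_bigr => a _ do rewrite scaler_suml.
under [RHS]eq_bigr => a _ do under eq_bigr => b _ do rewrite -young_sum_sandwich.
rewrite /young_sum.
under [LHS]eq_bigr => a _ do rewrite exchange_big /=.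
under [RHS]eq_bigr => a _ do rewrite exchange_big /=.
rewrite exchange_big [RHS]exchange_big; apply: eq_bigr => r _ /=.
under [LHS]eq_bigr => a _ do rewrite exchange_big /=.
under [RHS]eq_bigr => a _ do rewrite exchange_big /=.
rewrite exchange_big [RHS]exchange_big; apply: eq_bigr => c _ /=.
rewrite [RHS](reindex_inj (@perm_inj _ r)); apply: eq_bigr => a _.
rewrite [RHS](reindex_inj (@perm_inj _ r)); apply: eq_big => [b|b _].
  by rewrite (inj_eq perm_inj).
by rewrite -tpermJ conjgE !mulgA mulgV mul1g.
Qed.

End Values.

Section Words.

Variable N : nat.
Implicit Types w : {ffun 'I_n -> 'I_N}.

(** A transposition of two equal letters in one column fixes [w] and reverses the sign, so the terms
    cancel. *)
Lemma young_sum_word_fixed0 w : ~~ col_distinct lam (fun k : 'I_n => w k) ->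
  young_sum (fun s => (word_fixed s w)%:R : K^o) = 0.
Proof.
move=> ndist; have [k [l [ckl rkl kl]]] : exists k l : 'I_n, [/\ col k = col l, w k = w l & k != l].
  have [/existsP[k /existsP[l /and3P[/eqP ? /eqP ? ?]]]|no] := boolP [exists k : 'I_n,
    exists l : 'I_n, [&& col k == col l, w k == w l & k != l]].
    by exists k, l.
  case/negP: ndist; apply/col_distinctP=> k l ckl rkl; apply/eqP; apply: contraNT no => kl.
  by apply/existsP; exists k; apply/existsP; exists l; rewrite ckl (val_inj rkl) kl !eqxx.
rewrite /young_sum; apply: big1 => r _; apply: eq_opp_eq0.
rewrite -sumrN (reindex_inj (mulIg (tperm k l))) /=.
apply: eq_big => [c|c _]; first by rewrite groupMr // tperm_col.
rewrite odd_permM odd_tperm kl signr_addb expr1 mulrN1 scaleNr; congr (- (_ *: _)).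
have tw a : w (tperm k l a) = w a by case: tpermP => // ->.
congr (_%:R); congr nat_of_bool.
by apply/word_fixedP/word_fixedP => f a; rewrite -[RHS]f mulgA !permM ?tw.
Qed.

Lemma letter_mult_lt w m :
  #|[set k | (w k < m)%N]| = (\sum_(i : 'I_N | (i < m)%N) letter_mult w i)%N.
Proof.
rewrite /letter_mult exchange_big -sum1_card big_mkcond; apply: eq_bigr => k _ /=.
rewrite inE; case: ifP => wk.
  rewrite (bigD1 (w k)) //= eqxx big1 ?addn0 // => i /andP[_ iw].
  by rewrite eq_sym (negbTE iw).
by rewrite big1 // => i im; case: eqP => // E; rewrite E im in wk.
Qed.

Lemma young_sum_content w m : young_sum (fun s => (word_fixed s w)%:R : K^o) != 0 ->
  (\sum_(i : 'I_N | i < m) letter_mult w i <= \sum_(i < m) nth 0 lam i)%N.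
Proof.
move=> nz; rewrite -letter_mult_lt; apply: (col_distinct_dominated lamP).
by apply: contraNT nz => /young_sum_word_fixed0 ->.
Qed.

(** Among words of content [lam] only the words [w0 g] with [g] in the column group survive, by
    [col_sort_eq]. Such a word is fixed by x exactly when g^-1 x g preserves rows, and summing signs
    over [g] reproduces [young_scalar]. *)
Lemma young_sum_content_shape : (size lam <= N)%N ->
  \sum_(w : {ffun 'I_n -> 'I_N} | [forall i, letter_mult w i == nth 0%N lam i])
     young_sum (fun s => (word_fixed s w)%:R : K^o) = young_scalar.
Proof.
move=> leN.
pose w0 (g : 'S_n) : {ffun 'I_n -> 'I_N} :=
  [ffun k => widen_ord leN (Ordinal (row_lt lamP (g k)))].
have w0E g k : w0 g k = row (g k) :> nat by rewrite ffunE.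
have mult_w0 g i : letter_mult (w0 g) i = nth 0%N lam i.
  rewrite -(card_row lamP) /letter_mult -sum1_card [RHS]big_mkcond.
  rewrite [RHS](reindex_inj (@perm_inj _ g)) /=; apply: eq_bigr => k _.
  by rewrite inE -val_eqE /= w0E; case: eqP.
have sum_w w : (\sum_k w k = \sum_(i < N) i * letter_mult w i)%N.
  under [RHS]eq_bigr => i _ do rewrite big_distrr /=.
  rewrite exchange_big; apply: eq_bigr => k _ /=.
  rewrite (bigD1 (w k)) //= eqxx muln1 big1 ?addn0 // => i iw.
  by rewrite eq_sym (negbTE iw) muln0.
have w0_inj : {in C &, injective w0}.
  move=> g h gC hC /ffunP gh; apply/permP=> k; apply: (@row_col_inj _ lam).
    by rewrite -!w0E gh.
  by have /col_stabP-> := gC; have /col_stabP-> := hC.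
rewrite (bigID (fun w : {ffun 'I_n -> 'I_N} => col_distinct lam (fun k : 'I_n => w k))) /=.
rewrite [X in _ + X]big1 ?addr0 => [|w /andP[_ /young_sum_word_fixed0]//].
rewrite (eq_bigl (mem (w0 @: C))) => [|w]; last first.
  apply/andP/imsetP => [[/forallP wc dist]|[g gC ->]].
    have [|g gC gE] := col_sort_eq lamP dist.
      have -> : (\sum_(k < n) row k = \sum_k w0 1%g k)%N.
        by apply: eq_bigr => k _; rewrite w0E perm1.
      rewrite !sum_w; apply: leq_sum => i _.
      by rewrite mult_w0 (eqP (wc i)).
    by exists g => //; apply/ffunP=> k; apply: val_inj; rewrite /= gE w0E.
  split; first by apply/forallP=> i; rewrite mult_w0.
  apply/col_distinctP=> k l ckl; rewrite !w0E => rkl; apply: (@perm_inj _ g).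
  by apply: (@row_col_inj _ lam) => //; have /col_stabP gP := gC; rewrite !gP.
rewrite big_imset //= /young_scalar [RHS]exchange_big; apply: eq_bigr => g gC /=.
transitivity (\sum_(r in R) \sum_(c in C) \sum_(r' in R)
    (-1) ^+ odd_perm g * ((-1) ^+ odd_perm c *+ (r * c == g * r')%g) : K).
  apply: eq_bigr => r rR; rewrite (reindex_inj (mulIg (g^-1)%g)) /=.
  apply: eq_big => [c|c _]; first by rewrite groupMr ?groupV.
  rewrite odd_permM odd_permV signr_addb.
  have -> : word_fixed (r * (c * g^-1))%g (w0 g) = ((g^-1 * (r * c))%g \in R).
    apply/word_fixedP/row_stabP => f k.
      have /(congr1 val) := f (g^-1 k)%g; rewrite /= !w0E permKV => <-.
      by rewrite !permM permKV.
    by apply: val_inj; rewrite /= !w0E -[in RHS]f !permM permKV permK.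
  case: (boolP (_ \in R)) => [sR|sR].
    rewrite (bigD1 (g^-1 * (r * c))%g) //= mulKVg eqxx big1 ?addr0 => [|r' /andP[_ r's]].
      by rewrite /GRing.scale /= mulr1 mulrC.
    case: eqP => [E|_]; last by rewrite mulr0n mulr0.
    by rewrite E mulKg eqxx in r's.
  rewrite scaler0 big1 // => r' r'R.
  case: eqP => [E|_]; last by rewrite mulr0n mulr0.
  by rewrite E mulKg r'R in sR.
rewrite exchange_big /= /young_coef.
under eq_bigr => c _ do rewrite exchange_big /=.
rewrite exchange_big /=; apply: eq_bigr => r' _; rewrite mulr_sumr exchange_big /=.
by apply: eq_bigr => r _; rewrite mulr_sumr.
Qed.

End Words.
End YoungSums.

(** * Alternants and the Frobenius formula *)

Section Alternants.

Variables (K : comNzRingType) (N : nat).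
Implicit Types (l : 'I_N -> nat) (m : 'X_{1..N}) (p : {mpoly K[N]}).

Lemma euler_monomial i m : euler i 'X_[m] = 'X_[m] *+ m i :> {mpoly K[N]}.
Proof.
rewrite /euler mderivX; case: (posnP (m i)) => [->|mi]; first by rewrite scale0r mulr0.
rewrite -scalerAr -mpolyXD addmC submK ?scaler_nat //.
by apply/mnm_lepP=> j; rewrite mnm1E; case: eqP => // <-.
Qed.

Lemma mcoeff_euler i p m : (euler i p)@_m = p@_m *+ m i.
Proof.
rewrite {1}[p]mpolyE euler_sum raddf_sum /= [in RHS](mpolyE p) raddf_sum /= -sumrMnl.
apply: eq_bigr => m' _; rewrite /euler mderivZ -scalerAr -/(euler i _) euler_monomial.
by rewrite !mcoeffZ mcoeffMn mcoeffX -mulrnAr; case: eqP => [->|_]; rewrite ?mul0rn.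
Qed.

Definition alternant l : {mpoly K[N]} := \det (\matrix_(i, j) 'X_i ^+ l j).

Lemma alternantE l :
  alternant l = \sum_(s : 'S_N) (-1) ^+ s *: 'X_[[multinom l (s i) | i < N]].
Proof.
apply: eq_bigr => s _; rewrite scaler_sign mulr_sign.
have -> : \prod_i (\matrix_(i, j) 'X_i ^+ l j : 'M[{mpoly K[N]}]_N) i (s i) =
    'X_[[multinom l (s i) | i < N]].
  by rewrite mpolyXE_id; apply: eq_bigr => i _; rewrite mxE mnmE.
by [].
Qed.

Lemma mcoeff_alternant l m :
  (alternant l)@_m = \sum_(s : 'S_N) (-1) ^+ s *+ [forall i, m i == l (s i)].
Proof.
rewrite alternantE raddf_sum; apply: eq_bigr => s _ /=.
rewrite mcoeffZ mcoeffX mulr_natr; congr (_ *+ nat_of_bool _).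
apply/eqP/forallP => [<- i|H]; first by rewrite mnmE.
by apply/mnmP=> i; rewrite mnmE (eqP (H i)).
Qed.

Lemma msym_var (s : 'S_N) i : msym s 'X_i = 'X_(s i) :> {mpoly K[N]}.
Proof.
rewrite msymX; congr 'X_[_]; apply/mnmP=> j; rewrite !mnmE.
by rewrite -(inj_eq (@perm_inj _ s)) permKV.
Qed.

Lemma msym_alternant (s : 'S_N) l : msym s (alternant l) = (-1) ^+ s *: alternant l.
Proof.
rewrite /alternant -det_map_mx /=.
have -> : map_mx (msym s) (\matrix_(i, j) 'X_i ^+ l j) =
    row_perm s (\matrix_(i, j) 'X_i ^+ l j) :> 'M[{mpoly K[N]}]_N.
  by apply/matrixP=> i j; rewrite !mxE rmorphXn /= msym_var.
by rewrite row_permE det_mulmx det_perm mulr_sign scaler_sign.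
Qed.

Lemma msym_power_sum n (g : 'S_n) (s : 'S_N) : msym s (power_sum K N g) = power_sum K N g.
Proof.
rewrite /power_sum raddf_sum /=.
pose h (w : {ffun 'I_n -> 'I_N}) := [ffun k => s (w k)].
have h_inj : injective h.
  by move=> v w /ffunP vw; apply/ffunP=> k; have := vw k; rewrite !ffunE => /perm_inj.
rewrite [RHS](reindex_inj h_inj) /=; apply: eq_big => [w|w _].
  by apply: eq_forallb => k; rewrite !ffunE (inj_eq perm_inj).
by rewrite rmorph_prod; apply: eq_bigr => k _; rewrite /= msym_var ffunE.
Qed.

(** The operator multiplies a monomial by the sum of the squares of its exponents, and the monomials
    of an alternant share their exponents up to order. *)
Lemma sum_euler_alternant l :
  \sum_i euler i (euler i (alternant l)) = (\sum_i l i * l i)%N%:R *: alternant l.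
Proof.
apply/mpolyP=> m; rewrite raddf_sum /= mcoeffZ mcoeff_alternant mulr_sumr.
under eq_bigr => i _ do rewrite !mcoeff_euler -mulrnA mcoeff_alternant -sumrMnl.
rewrite exchange_big; apply: eq_bigr => s _ /=; rewrite sumrMnr.
case: forallP => [ml|_]; last by rewrite mul0rn mulr0.
rewrite mulr_natl; congr (_ *+ _); rewrite [RHS](reindex_inj (@perm_inj _ s)).
by apply: eq_bigr => i _; rewrite (eqP (ml i)).
Qed.

Definition delta (i : 'I_N) : nat := N - i.+1.

Lemma alternant_delta : exists c, alternant delta = c *: vandermonde_prod K N.
Proof.
have revE (i : 'I_N) : delta i = rev_ord i by [].
pose V : 'M[{mpoly K[N]}]_N := Vandermonde N (\row_j 'X_j).
have -> : alternant delta = \det (row_perm (perm rev_ord_inj) V).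
  rewrite -det_tr; congr (\det _); apply/matrixP=> i j.
  by rewrite !mxE permE revE.
rewrite row_permE det_mulmx det_perm det_Vandermonde pair_big_dep /=.
have -> : \prod_(p : 'I_N * 'I_N | (p.1 < p.2)%N)
    ((\row_j 'X_j) 0 p.2 - (\row_j 'X_j) 0 p.1) =
    (-1) ^+ #|[pred p : 'I_N * 'I_N | (p.1 < p.2)%N]| * vandermonde_prod K N.
  by rewrite -prodrN; apply: eq_bigr => p _; rewrite !mxE opprB.
rewrite mulrA -exprD -signr_odd; exists ((-1) ^+ odd (perm (@rev_ord_inj N) +
   #|[pred p : 'I_N * 'I_N | (p.1 < p.2)%N]|)).
by rewrite mulr_sign scaler_sign.
Qed.

End Alternants.

(** * Dominance expressed through partial sums *)

Section PartialSums.

Variable N : nat.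
Implicit Types (f g : 'I_N -> nat) (i : 'I_N) (k : nat).

Definition psum f k : nat := (\sum_(i < N | i < k) f i)%N.

Lemma psumS f i : psum f i.+1 = (psum f i + f i)%N.
Proof.
rewrite /psum (bigD1 i) //= addnC; congr (_ + _)%N; apply: eq_bigl => j.
by rewrite -val_eqE /= ltnS leq_eqVlt; case: ltngtP.
Qed.

Lemma psumD f g k : psum (fun i => f i + g i)%N k = (psum f k + psum g k)%N.
Proof. exact: big_split. Qed.

Lemma psum_inj f g : (forall k, psum f k = psum g k) -> f =1 g.
Proof. by move=> fg i; apply: (@addnI (psum f i)); rewrite -psumS !fg psumS. Qed.

Lemma psum_all f : psum f N = (\sum_i f i)%N.
Proof. by apply: eq_bigl => i; rewrite ltn_ord. Qed.

(** Compare the set A of the values [s i] for i < k with the set B of the first k indices. Outside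
    their intersection, [delta] is at most N - k on A and at least N - k on B, and both remainders
    have the same size. *)
Lemma psum_delta_perm (s : 'S_N) k : (psum (fun i => delta (s i)) k <= psum (@delta N) k)%N.
Proof.
have [kN|Nk] := leqP k N; last first.
  rewrite eq_leq // /psum [RHS](reindex_inj (@perm_inj _ s)).
  by apply: eq_bigl => i; rewrite !(ltn_trans (ltn_ord _) Nk).
pose A := [pred j | (s^-1 j < k)%N]%g; pose B := [pred j : 'I_N | (j < k)%N].
have -> : psum (fun i => delta (s i)) k = (\sum_(j | A j) delta j)%N.
  by rewrite [RHS](reindex_inj (@perm_inj _ s)); apply: eq_bigl => i; rewrite /= permK.
have cAB : #|A| = #|B|.
  rewrite -(card_imset B (@perm_inj _ s)); apply: eq_card => j.
  apply/idP/imsetP => [jA|[i iB ->]]; last by rewrite inE /= permK.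
  by exists (s^-1 j)%g; rewrite ?permKV.
have AB_BA : #|[predD A & B]| = #|[predD B & A]|.
  apply: (@addnI #|[predI A & B]|); rewrite cardID cAB -(cardID A B).
  by congr (_ + _)%N; apply: eq_card => j; rewrite !inE andbC.
rewrite /psum (bigID B) /= [X in (_ <= X)%N](bigID A) /= leq_add //.
  by rewrite eq_leq //; apply: eq_bigl => j; rewrite andbC.
apply: (@leq_trans (\sum_(j in [predD A & B]) (N - k))%N).
  rewrite [X in (_ <= X)%N](eq_bigl (fun j => A j && ~~ B j)) => [|j]; last by rewrite !inE andbC.
  by apply: leq_sum => j /andP[_]; rewrite /delta /= -leqNgt; lia.
rewrite sum_nat_const AB_BA -sum_nat_const.
rewrite [X in (X <= _)%N](eq_bigl (fun j => B j && ~~ A j)) => [|j]; last by rewrite !inE andbC.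
by apply: leq_sum => j /andP[]; rewrite /delta /=; lia.
Qed.

(* Abel summation of sum_i (g i - f i) (g i + f i). *)
Lemma psum_dominated_eq f g :
  (forall k, psum f k <= psum g k)%N -> psum f N = psum g N ->
  (forall i j : 'I_N, (i < j)%N -> g j < g i)%N -> (forall i j : 'I_N, (i <= j)%N -> f j <= f i)%N ->
  (\sum_i f i * f i = \sum_i g i * g i)%N -> f =1 g.
Proof.
move=> le_fg fgN g_lt f_le sqr_eq.
pose ext (h : 'I_N -> nat) k := (psum h k.+1 - psum h k)%N.
have extE h (i : 'I_N) : ext h i = h i by rewrite /ext psumS addKn.
have sum_ext h k : (k <= N)%N -> (\sum_(i < k) ext h i = psum h k)%N.
  move=> kN; rewrite (big_ord_widen N (ext h) kN).
  by apply: eq_bigr => i _; rewrite extE.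
pose d k : int := (ext g k)%:Z - (ext f k)%:Z.
pose s k : int := (ext g k)%:Z + (ext f k)%:Z.
have abel M : \sum_(i < M) d i * s i =
    \sum_(k < M) (\sum_(i < k.+1) d i) * (s k - s k.+1) + (\sum_(i < M) d i) * s M.
  elim: M => [|M IH]; first by rewrite !big_ord0; ring.
  by rewrite big_ord_recr [in RHS]big_ord_recr /= IH !big_ord_recr /=; ring.
have sum_d k : (k <= N)%N -> \sum_(i < k) d i = (psum g k)%:Z - (psum f k)%:Z.
  by move=> kN; rewrite sumrB -!sum_ext // !rmorph_sum.
have s_lt k : (k.+1 < N)%N -> s k.+1 < s k.
  move=> kN; have kk : (Ordinal (ltnW kN) < Ordinal kN)%N by [].
  have := g_lt _ _ kk; have := f_le _ _ (ltnW kk).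
  rewrite -(extE g (Ordinal kN)) -(extE g (Ordinal (ltnW kN))) /=.
  rewrite -(extE f (Ordinal kN)) -(extE f (Ordinal (ltnW kN))) /= /s.
  by rewrite -!PoszD ltz_nat => H1 H2; rewrite -addSn leq_add.
have := abel N; rewrite sum_d // fgN subrr mul0r addr0.
have -> : \sum_(i < N) d i * s i = 0.
  transitivity ((\sum_i g i * g i)%N%:Z - (\sum_i f i * f i)%N%:Z); last by rewrite sqr_eq subrr.
  rewrite !rmorph_sum -sumrB; apply: eq_bigr => i _ /=.
  by rewrite /d /s !extE !PoszM; ring.
(* The Abel sum vanishes and its terms are nonnegative, so each is zero; since [s] strictly
   decreases, the partial sums of [f] and [g] agree. *)
move=> /esym/eqP; rewrite psumr_eq0 => [/allP D0|k _]; last first.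
  rewrite sum_d //; have [kN|Nk] := ltnP k.+1 N.
    by apply: mulr_ge0; rewrite subr_ge0; [rewrite lez_nat le_fg | apply/ltW/s_lt].
  have -> : k.+1 = N by apply/eqP; rewrite eqn_leq Nk ltn_ord.
  by rewrite fgN subrr mul0r.
apply: psum_inj => k; have [kN|Nk] := ltnP k N; last first.
  have psum_ge h : psum h k = psum h N.
    by apply: eq_bigl => i; rewrite ltn_ord (leq_trans (ltn_ord i)).
  by rewrite !psum_ge.
case: k kN => [|k] kN; first by rewrite /psum !big_pred0.
have := D0 (Ordinal (ltnW kN)) (mem_index_enum _); rewrite sum_d ?(ltnW kN) //=.
by rewrite mulf_eq0 !subr_eq0 (gt_eqF (s_lt k kN)) orbF eqz_nat => /eqP.
Qed.

Lemma sort_perm f : exists s : 'S_N, forall i j : 'I_N, (i <= j)%N -> (f (s j) <= f (s i))%N.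
Proof.
pose t := [tuple f i | i < N].
have /tuple_permP[s tE] : perm_eq (sort geq t) t by rewrite perm_sort.
exists s => i j ij.
have fE a : f (s a) = nth 0%N (sort geq t) a.
  by rewrite tE (nth_map a) ?size_enum_ord // nth_ord_enum tnth_mktuple.
have geq_trans : transitive geq by move=> a b d ab bd; apply: leq_trans bd ab.
have geq_total : total geq by move=> a b; apply: leq_total.
rewrite !fE; apply: (sorted_leq_nth geq_trans leqnn 0%N (sort_sorted geq_total t)) => //;
  by rewrite inE size_sort size_tuple.
Qed.

End PartialSums.

Section YoungSumLinearity.

Variables (n : nat) (lam : seq nat) (K : fieldType) (V V' : lmodType K).
Implicit Types phi psi : 'S_n -> V.

Lemma young_sumD phi psi :
  young_sum lam (fun s => phi s + psi s) = young_sum lam phi + young_sum lam psi.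
Proof.
rewrite -big_split; apply: eq_bigr => r _; rewrite -big_split.
by apply: eq_bigr => c _; rewrite scalerDr.
Qed.

Lemma young_sum_sum (I : finType) (P : pred I) (phi : I -> 'S_n -> V) :
  young_sum lam (fun s => \sum_(i | P i) phi i s) = \sum_(i | P i) young_sum lam (phi i).
Proof.
rewrite [RHS]exchange_big; apply: eq_bigr => r _; rewrite [RHS]exchange_big.
by apply: eq_bigr => c _; rewrite scaler_sumr.
Qed.

Lemma linear_young_sum (f : V -> V') phi : linear f ->
  f (young_sum lam phi) = young_sum lam (fun s => f (phi s)).
Proof.
move=> f_lin; have f0 : f 0 = 0.
  have := f_lin (-1) 0 0; rewrite scaler0 addr0 scaleN1r => ->; exact: addNr.
have fD : {morph f : x y / x + y} by move=> x y; have := f_lin 1 x y; rewrite !scale1r.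
have fZ a x : f (a *: x) = a *: f x by have := f_lin a x 0; rewrite f0 !addr0.
rewrite (big_morph f fD f0); apply: eq_bigr => r _; rewrite (big_morph f fD f0).
by apply: eq_bigr => c _; rewrite fZ.
Qed.

End YoungSumLinearity.

(** * The bialternant formula for the Young symmetrizer *)

Section Frobenius.

Variables (n : nat) (lam : seq nat).
Hypothesis lamP : is_partition n lam.
Variables (K : fieldType) (N : nat).
Hypotheses (pcharK : [pchar K] =i pred0) (leN : (size lam <= N)%N).
Hypothesis scalar_neq0 : young_scalar n lam K != 0.

Definition shifted_part (i : 'I_N) : nat := (nth 0 lam i + delta i)%N.

Let Y (w : {ffun 'I_n -> 'I_N}) : K := young_sum lam (fun s => (word_fixed s w)%:R : K^o).
Let T : {mpoly K[N]} := young_sum lam (@power_sum K n N).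
Let F := T * alternant K (@delta N).

Let K2 : 2%:R != 0 :> K.
Proof. by have/pcharf0P -> := pcharK. Qed.

Lemma word_monE (w : {ffun 'I_n -> 'I_N}) :
  word_mon K w = 'X_[[multinom letter_mult w i | i < N]].
Proof.
rewrite /word_mon mprodXE; congr 'X_[_]; apply/mnmP=> i; rewrite mnmE mnm_sumE.
by apply: eq_bigr => k _; rewrite mnm1E.
Qed.

Let mcoeffF m : F@_m = \sum_(w : {ffun 'I_n -> 'I_N}) \sum_(s : 'S_N)
  Y w * ((-1) ^+ s *+ [forall i, m i == letter_mult w i + delta (s i)]%N).
Proof.
have -> : F = \sum_(w : {ffun 'I_n -> 'I_N}) \sum_(s : 'S_N)
    (Y w * (-1) ^+ s) *: 'X_[[multinom letter_mult w i + delta (s i) | i < N]%N].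
  have -> : F = (\sum_w Y w *: word_mon K w) * alternant K (@delta N).
    congr (_ * _); rewrite /T /Y /young_sum; under [RHS]eq_bigr => w _ do rewrite scaler_suml.
    rewrite [RHS]exchange_big; apply: eq_bigr => r _ /=.
    under [RHS]eq_bigr => w _ do rewrite scaler_suml.
    rewrite [RHS]exchange_big; apply: eq_bigr => c _ /=.
    rewrite /power_sum scaler_sumr big_mkcond; apply: eq_bigr => w _ /=.
    by case: ifP => _; rewrite -scalerA ?scale1r ?scale0r ?scaler0.
  rewrite mulr_suml; apply: eq_bigr => w _; rewrite alternantE mulr_sumr.
  apply: eq_bigr => s _; rewrite -scalerAl -scalerAr scalerA word_monE -mpolyXD.
  by congr (_ *: 'X_[_]); apply/mnmP=> i; rewrite mnmDE !mnmE.
rewrite raddf_sum; apply: eq_bigr => w _; rewrite raddf_sum; apply: eq_bigr => s _ /=.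
rewrite mcoeffZ mcoeffX -mulrA mulr_natr; congr (_ * (_ *+ nat_of_bool _)).
apply/eqP/forallP => [<- i|H]; first by rewrite mnmE.
by apply/mnmP=> i; rewrite mnmE (eqP (H i)).
Qed.

Let mcoeffF_neq0 m : F@_m != 0 -> exists (w : {ffun 'I_n -> 'I_N}) (s : 'S_N), Y w != 0 /\
  forall i, m i = (letter_mult w i + delta (s i))%N.
Proof.
move=> nz; have [/existsP[w /existsP[s /andP[Yw /forallP H]]]|no] :=
  boolP [exists w : {ffun 'I_n -> 'I_N}, exists s : 'S_N,
     (Y w != 0) && [forall i, m i == letter_mult w i + delta (s i)]%N].
  by exists w, s; split=> // i; apply/eqP.
case/eqP: nz; rewrite mcoeffF; apply: big1 => w _; apply: big1 => s _.
case: forallP => [H|]; last by rewrite mulr0n mulr0.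
have [-> //|Yw] := eqVneq (Y w) 0; first by rewrite mul0r.
case/negP: no; apply/existsP; exists w; apply/existsP; exists s; rewrite Yw.
exact/forallP.
Qed.

Let psum_nth k : (\sum_(i < k) nth 0 lam i = psum (fun i : 'I_N => nth 0 lam i) k)%N.
Proof.
have [kN|Nk] := leqP k N; first exact: (big_ord_widen N (fun i => nth 0%N lam i) kN).
rewrite -(big_mkord xpredT (fun i => nth 0%N lam i)) (big_cat_nat (leq0n N) (ltnW Nk)) /=.
rewrite [X in (_ + X)%N]big1_seq ?addn0 => [|i /andP[_]]; last first.
  by rewrite mem_index_iota => /andP[Ni _]; rewrite nth_default // (leq_trans leN).
rewrite big_mkord; apply: eq_bigl => i; by rewrite (ltn_trans (ltn_ord i)).
Qed.

Let psum_letter_mult w k : Y w != 0 ->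
  (psum (letter_mult w) k <= psum (fun i : 'I_N => nth 0 lam i) k)%N.
Proof. by move=> Yw; rewrite -psum_nth; apply: (young_sum_content lamP K2). Qed.

Let psum_mcoeffF m k : F@_m != 0 -> (psum m k <= psum shifted_part k)%N.
Proof.
move=> /mcoeffF_neq0[w [s [Yw mE]]].
rewrite /shifted_part psumD; have -> : psum m k = psum (fun i => letter_mult w i + delta (s i))%N k.
  by apply: eq_bigr => i _; rewrite mE.
by rewrite psumD leq_add ?psum_letter_mult ?psum_delta_perm.
Qed.

(** Reaching the exponent lam + delta forces equality in both dominance bounds, hence content [lam]
    and the identity permutation; [young_sum_content_shape] sums what is left. *)
Let mcoeffF_shifted : F@_[multinom shifted_part i | i < N] = young_scalar n lam K.
Proof.
rewrite mcoeffF -(young_sum_content_shape lamP K2 leN) [RHS]big_mkcond /=.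
apply: eq_bigr => w _; rewrite -/(Y w); have [->|Yw] := eqVneq (Y w) 0.
  by rewrite big1 ?if_same // => s _; rewrite mul0r.
have eqs (s : 'S_N) : (forall i, shifted_part i = (letter_mult w i + delta (s i))%N) ->
    letter_mult w =1 (fun i : 'I_N => nth 0%N lam i) /\ s = 1%g.
  move=> LE; have psE k : psum (letter_mult w) k = psum (fun i : 'I_N => nth 0%N lam i) k /\
      psum (fun i => delta (s i)) k = psum (@delta N) k.
    have := psum_letter_mult k Yw; have := psum_delta_perm s k.
    have : psum shifted_part k = psum (fun i => letter_mult w i + delta (s i))%N k.
      by apply: eq_bigr => i _; rewrite LE.
    by rewrite /shifted_part !psumD; lia.
  split; first by apply: psum_inj => k; case: (psE k).
  have dE : (fun i => delta (s i)) =1 @delta N by apply: psum_inj => k; case: (psE k).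
  apply/permP=> i; rewrite perm1; apply: val_inj.
  have := dE i; rewrite /delta /=; have := ltn_ord i; have := ltn_ord (s i); lia.
case: forallP => [wE|wE]; last first.
  rewrite big1 // => s _; case: forallP => [H|]; last by rewrite mulr0n mulr0.
  case: wE => i; have [|-> //] := eqs s.
  by move=> j; have /eqP := H j; rewrite mnmE.
rewrite (bigD1 1%g) //= odd_perm1 big1 ?addr0 => [|s s1].
  case: forallP => [_|[]]; first by rewrite mulr1.
  by move=> i; rewrite mnmE perm1 (eqP (wE i)).
case: forallP => [H|]; last by rewrite mulr0n mulr0.
case/eqP: s1; have [|//] := eqs s.
by move=> j; have /eqP := H j; rewrite mnmE.
Qed.

Let mcoeffF_sum m : F@_m != 0 -> (\sum_i m i = \sum_i shifted_part i)%N.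
Proof.
have sumE m' : F@_m' != 0 -> (\sum_i m' i = n + \sum_i delta (i : 'I_N))%N.
  case/mcoeffF_neq0=> w [s [_ mE]]; under eq_bigr => i _ do rewrite mE.
  by rewrite big_split sum_letter_mult /= [in RHS](reindex_inj (@perm_inj _ s)).
move/sumE->; rewrite -(sumE [multinom shifted_part i | i < N]) ?mcoeffF_shifted //.
by apply: eq_bigr => i _; rewrite mnmE.
Qed.

(** [F] is an eigenvector of the second-order Euler operator, because the sum of transpositions acts
    on the symmetrizer by a scalar. Every exponent in its support therefore has the same sum of
    squares as lam + delta. *)
Let mcoeffF_sqr m : F@_m != 0 -> (\sum_i m i * m i = \sum_i shifted_part i * shifted_part i)%N.
Proof.
have natr_inj (a b : nat) : a%:R = b%:R :> K -> a = b.
  wlog le_ab : a b / (a <= b)%N => [H E|].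
    by have [/H->|/ltnW/H->] := leqP a b.
  move/esym/eqP; rewrite -subr_eq0 -natrB //; have/pcharf0P -> := pcharK.
  by rewrite subn_eq0 => le_ba; apply/eqP; rewrite eqn_leq le_ab.
have [z Fz] : exists z : K, \sum_i euler i (euler i F) = z *: F.
  have [c W] := alternant_delta K N.
  (* The scalar of the transposition sum, the constant from homogeneity, and the eigenvalue of the
     alternant of [delta]. *)
  exists ((\sum_(a : 'I_n) \sum_(b | b != a) young_coef lam K (tperm a b)) +
    (n + 2 * n * N.-1)%:R + (\sum_i @delta N i * delta i)%N%:R).
  rewrite /F /T W; set W' := c *: _.
  pose lap (p : {mpoly K[N]}) : {mpoly K[N]} := \sum_i euler i (euler i p).
  have lapW : lap W' = (\sum_i @delta N i * delta i)%N%:R *: W'.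
    by rewrite /W' -W; apply: sum_euler_alternant.
  have lin : linear (fun p => lap (p * W')).
    move=> a p q; rewrite mulrDl -scalerAl /lap scaler_sumr -big_split.
    apply: eq_bigr => i _ /=; rewrite !eulerD; congr (_ + _).
    by rewrite /euler !mderivZ -!scalerAr mderivZ -scalerAr.
  have linW : linear (fun p => p * W') by move=> a p q; rewrite mulrDl scalerAl.
  rewrite -/(lap _) (linear_young_sum _ _ lin) (linear_young_sum _ _ linW).
  have E (s : 'S_n) : lap (power_sum K N s * W') =
      \sum_a \sum_(b | b != a) power_sum K N (tperm a b * s)%g * W' +
      ((n + 2 * n * N.-1)%:R + (\sum_i @delta N i * delta i)%N%:R) *: (power_sum K N s * W').
    rewrite /lap power_sum_vandermonde_eigen -/W' -/(lap W') lapW mulrDl -addrA.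
    congr (_ + _).
      by rewrite mulr_suml; apply: eq_bigr => a _; rewrite mulr_suml.
    by rewrite scalerDl; congr (_ + _); [rewrite scaler_nat mulrnAl | rewrite -scalerAr].
  transitivity (young_sum lam (fun s : 'S_n =>
    \sum_a \sum_(b | b != a) power_sum K N (tperm a b * s)%g * W' +
      ((n + 2 * n * N.-1)%:R + (\sum_i @delta N i * delta i)%N%:R) *: (power_sum K N s * W'))).
    by apply: eq_bigr => r _; apply: eq_bigr => c' _; rewrite E.
  have linZ : linear (fun p : {mpoly K[N]} =>
     ((n + 2 * n * N.-1)%:R + (\sum_i @delta N i * delta i)%N%:R : K) *: p).
    by move=> a p q; rewrite scalerDr !scalerA mulrC.
  rewrite young_sumD -(linear_young_sum _ _ linZ) -addrA [RHS]scalerDl; congr (_ + _).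
  rewrite young_sum_sum; under eq_bigr => a _ do rewrite young_sum_sum.
  exact: (young_sum_tperm lamP K2 (fun s => power_sum K N s * W')).
have sqrE m' : F@_m' != 0 -> (\sum_i m' i * m' i)%N%:R = z.
  move=> nz; have := congr1 (mcoeff m') Fz; rewrite mcoeffZ raddf_sum /=.
  under eq_bigr => i _ do rewrite !mcoeff_euler -mulrnA.
  by rewrite sumrMnr => E; apply: (mulIf nz); rewrite mulr_natl.
move=> /sqrE mz; apply: natr_inj; rewrite mz.
rewrite -(sqrE [multinom shifted_part i | i < N]) ?mcoeffF_shifted //.
by congr (_%:R); apply: eq_bigr => i _; rewrite mnmE.
Qed.

Local Notation "m # s" := [multinom m (s i) | i < N]
  (at level 40, left associativity, format "m # s").

Let mcoeffF_perm (s : 'S_N) (m : 'X_{1..N}) : F@_(m # s) = (-1) ^+ s * F@_m.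
Proof.
rewrite -mcoeff_sym rmorphM /= msym_alternant -scalerAr mcoeffZ; congr (_ * (_ * _)@_m).
rewrite /T /young_sum raddf_sum; apply: eq_bigr => r _.
by rewrite raddf_sum; apply: eq_bigr => c _; rewrite /= msymZ msym_power_sum.
Qed.

(** Both sides are antisymmetric, so exponents may be sorted. A sorted exponent in the support of
    the left side is dominated by lam + delta and has the same sum and sum of squares, hence equals
    it by [psum_dominated_eq]. *)
Lemma frobenius_formula :
  young_sum lam (@power_sum K n N) * alternant K (@delta N) =
  young_scalar n lam K *: alternant K shifted_part.
Proof.
have alt_perm (s : 'S_N) (m : 'X_{1..N}) : (alternant K shifted_part)@_(m # s) = (-1) ^+ s * (alternant K shifted_part)@_m.
  by rewrite -mcoeff_sym msym_alternant mcoeffZ.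
pose L := [multinom shifted_part i | i < N].
have L_lt (i j : 'I_N) : (i < j)%N -> (shifted_part j < shifted_part i)%N.
  move=> ij; have := nth_part_le lamP (ltnW ij).
  by rewrite /shifted_part /delta; have := ltn_ord j; lia.
have altL : (alternant K shifted_part)@_L = 1.
  rewrite mcoeff_alternant (bigD1 1%g) //= odd_perm1 big1 ?addr0 => [|s s1].
    by case: forallP => // -[] i; rewrite mnmE perm1.
  case: forallP => // H; case/eqP: s1; apply/permP=> i; rewrite perm1; apply: val_inj.
  have /eqP := H i; rewrite mnmE.
  by case: (ltngtP i (s i)) => /= [/L_lt lt E|/L_lt lt E|/esym //]; rewrite E ltnn in lt.
apply/mpolyP=> m; rewrite mcoeffZ -/T -/F.
have signK (s : 'S_N) : (-1) ^+ s * (-1) ^+ s = 1 :> K by rewrite -signr_addb addbb.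
have [F0|Fm] := eqVneq F@_m 0.
  rewrite F0 mcoeff_alternant big1 ?mulr0 // => s _; case: forallP => // H.
  have mL : m = L # s by apply/mnmP=> i; rewrite !mnmE; apply/eqP.
  by move: F0 scalar_neq0; rewrite mL mcoeffF_perm mcoeffF_shifted => /eqP; rewrite mulf_eq0 signr_eq0 /= => ->.
have [s s_le] := sort_perm m.
have msL : m # s = L.
  have Fms : F@_(m # s) != 0 by rewrite mcoeffF_perm mulf_eq0 signr_eq0.
  apply/mnmP=> i; rewrite [RHS]mnmE; apply: psum_dominated_eq i.
  - by move=> k; apply: psum_mcoeffF.
  - by rewrite !psum_all mcoeffF_sum.
  - exact: L_lt.
  - by move=> i j ij; rewrite !mnmE s_le.
  exact: mcoeffF_sqr.
have F1 := mcoeffF_perm s m; have A1 := alt_perm s m.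
rewrite msL mcoeffF_shifted in F1; rewrite msL altL in A1.
have signE (x y : K) : y = (-1) ^+ s * x -> x = (-1) ^+ s * y.
  by move=> ->; rewrite mulrA signK mul1r.
by rewrite (signE _ _ F1) (signE _ _ A1) mulr1 mulrC.
Qed.

End Frobenius.

(** * Hooks and the principal specialization *)

Section Hooks.

Variables (n : nat) (lam : seq nat).
Hypothesis lamP : is_partition n lam.

Lemma lt_col_length k j : (k < col_length lam j)%N = (j < nth 0 lam k)%N.
Proof.
case/and3P: lamP => srt _ _; rewrite /col_length.
elim: lam srt k => [|a l IH] /= srt k; first by rewrite nth_nil.
have geq_trans : transitive geq by move=> x y z xy yz; apply: leq_trans yz xy.
have [ja|aj] := ltnP j a; first by case: k => [|k] //=; rewrite add1n ltnS IH ?(path_sorted srt).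
have le_a : all (geq a) l by apply: order_path_min srt.
rewrite add0n (eq_in_count (a2 := pred0)) => [|x xl] /=; last first.
  by apply/negbTE; rewrite -leqNgt (leq_trans _ aj) //; apply: (allP le_a).
rewrite count_pred0; case: k => [|k] /=; first by rewrite (ltnNge j) aj.
have [kl|lk] := ltnP k (size l); last by rewrite nth_default.
by apply/esym/negbTE; rewrite -leqNgt (leq_trans _ aj) //; apply: (allP le_a); apply: mem_nth.
Qed.

(** With L = lam + delta, the differences L_i - L_k for k > i and the hook lengths of row i fill 1,
    ..., L_i exactly once: they lie in this interval, are distinct, and number L_i. *)
Lemma prod_hooks_row (R : comNzRingType) (g : nat -> R) N (i : 'I_N) : (size lam <= N)%N ->
  (\prod_(k < N | (i < k)%N) g (shifted_part lam i - shifted_part lam k)%N) *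
    \prod_(c < nth 0%N lam i) g (hook_length lam i c) =
  \prod_(m < shifted_part lam i) g m.+1.
Proof.
move=> leN; set Li := shifted_part lam i.
pose s1 := [seq (Li - (nth 0 lam k + (N - k.+1)))%N | k <- iota i.+1 (N - i.+1)].
pose s2 := [seq hook_length lam i c | c <- iota 0 (nth 0%N lam i)].
have -> : \prod_(k < N | (i < k)%N) g (Li - shifted_part lam k)%N = \prod_(m <- s1) g m.
  by rewrite big_map -/(index_iota _ _) big_geq_mkord.
have -> : \prod_(c < nth 0%N lam i) g (hook_length lam i c) = \prod_(m <- s2) g m.
  by rewrite big_map -[X in iota 0 X]subn0 -/(index_iota _ _) big_mkord.
have -> : \prod_(m < Li) g m.+1 = \prod_(m <- iota 1 Li) g m.
  by rewrite (iotaDl 1 0) big_map -[X in iota 0 X]subn0 -/(index_iota _ _) big_mkord.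
rewrite -big_cat; apply: perm_big.
have hookE c : (c < nth 0 lam i)%N -> [/\ (i < col_length lam c)%N &
    hook_length lam i c = (nth 0 lam i - c + (col_length lam c - i.+1))%N].
  by move=> ci; rewrite lt_col_length /hook_length -[lam`_i]/(nth 0%N lam i); split=> //; lia.
have iN := ltn_ord i.
have partE k : (i < k < N)%N -> (Li - (nth 0 lam k + (N - k.+1)))%N =
    (nth 0 lam i - nth 0 lam k + (k - i))%N.
  move=> /andP[ik kN]; have := nth_part_le lamP (ltnW ik).
  by rewrite /Li /shifted_part /delta; lia.
have col_le c c' : (c <= c')%N -> (col_length lam c' <= col_length lam c)%N.
  move=> cc; apply: sub_count => x; apply: leq_ltn_trans cc.
have uniq_s : uniq (s1 ++ s2).
  rewrite cat_uniq; apply/and3P; split.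
  - rewrite map_inj_in_uniq ?iota_uniq // => k l.
    rewrite !mem_iota !(subnKC iN) => kP lP; rewrite !partE // => E.
    have ik : (i <= k)%N by lia.
    have il : (i <= l)%N by lia.
    have := nth_part_le lamP ik; have := nth_part_le lamP il.
    by case: (ltngtP k l) => // kl; have := nth_part_le lamP (ltnW kl); lia.
  (* No hook length of row i is a difference: if c < lam_k, equivalently k < [col_length lam c], the
     hook is longer than L_i - L_k, and otherwise it is shorter. *)
  - apply/hasPn=> x /mapP[c]; rewrite mem_iota add0n => /andP[_ ci] ->.
    apply/mapP=> -[k]; rewrite mem_iota => kP; rewrite partE; last by lia.
    have [ic ->] := hookE c ci; have ik : (i <= k)%N by lia.
    have := nth_part_le lamP ik; have := lt_col_length k c; lia.
  rewrite map_inj_in_uniq ?iota_uniq // => c c'; rewrite !mem_iota !add0n /=.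
  move=> ci ci' E; apply/eqP; move: E.
  have [_ ->] := hookE c ci; have [_ ->] := hookE c' ci'.
  by case: (ltngtP c c') => // cc; have := col_le _ _ (ltnW cc); lia.
have size_s : size (s1 ++ s2) = Li.
  rewrite size_cat !size_map !size_iota /Li /shifted_part /delta; lia.
have sub_s : {subset s1 ++ s2 <= iota 1 Li}.
  move=> x; rewrite mem_cat mem_iota => /orP[/mapP[k]|/mapP[c]].
    rewrite mem_iota => kP ->; rewrite partE; last by lia.
    by rewrite /Li /shifted_part /delta; lia.
  rewrite mem_iota add0n => /andP[_ ci] ->; have [ic ->] := hookE c ci.
  have cs : (col_length lam c <= N)%N.
    exact: leq_trans (count_size _ _) leN.
  by rewrite /Li /shifted_part /delta; lia.
have [|_ mem_s] := uniq_min_size uniq_s sub_s; first by rewrite size_iota size_s.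
exact: uniq_perm uniq_s (iota_uniq _ _) mem_s.
Qed.


End Hooks.

Lemma rmorph_wperm_det (R S : comNzRingType) (f : {rmorphism R -> S}) n (d : 'I_n -> R) s :
  f (wperm_det d s) = wperm_det (f \o d) s.
Proof.
rewrite /wperm_det -det_map_mx map_mxB map_mx1; congr (\det (_ - _)).
by apply/matrixP=> i j; rewrite !mxE /= rmorphMn.
Qed.

(** The multiplicative set for [wperm_det_neq0] and [sign_sum_det]; it avoids 1 when [t] is not a
    root of unity. *)
Definition pos_power (F : fieldType) (t x : F) := x = 0 \/ exists m, x = t ^+ m.+1.

Lemma pos_powerM (F : fieldType) (t x y : F) :
  pos_power t x -> pos_power t y -> pos_power t (x * y).
Proof.
case=> [->|[a ->]]; first by left; rewrite mul0r.
case=> [->|[b ->]]; first by left; rewrite mulr0.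
by right; exists (a + b).+1; rewrite -exprD addSn addnS.
Qed.

Lemma pos_power_neq1 (F : fieldType) (t : F) :
  (forall m, t ^+ m.+1 != 1) -> ~ pos_power t 1.
Proof.
move=> t1; case=> [/eqP|[m /esym/eqP]]; first by rewrite oner_eq0.
by rewrite (negbTE (t1 m)).
Qed.

(** * Evaluation at powers of t and the hook-content formula *)

Section Specialization.

Variables (n : nat) (lam : seq nat).
Hypothesis lamP : is_partition n lam.
Variables (K : fieldType) (t : K).
Hypotheses (pcharK : [pchar K] =i pred0) (scalar_neq0 : young_scalar n lam K != 0).
Hypotheses (t_neq0 : t != 0) (t_neq1 : forall m, t ^+ m.+1 != 1).

Definition scaled_det (R : comNzRingType) (u : R) (s : 'S_n) : R := wperm_det (fun=> u) s.

Lemma scaled_det_neq0 s : scaled_det t s != 0.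
Proof.
apply: (@wperm_det_neq0 _ _ (pos_power t)); first by left.
- exact: pos_powerM.
- exact: pos_power_neq1.
by move=> _; right; exists 0%N.
Qed.

Lemma horner_scaled_det x (s : 'S_n) : (scaled_det ('X : {poly K}) s).[x] = scaled_det x s.
Proof.
rewrite -/(horner_eval x _) /scaled_det rmorph_wperm_det.
by apply: eq_wperm_det => k; rewrite /= /horner_eval hornerX.
Qed.

Lemma meval_power_sum N (s : 'S_n) :
  meval (fun i : 'I_N.+1 => t ^+ i) (power_sum K N.+1 s) =
  scaled_det (t ^+ N.+1) s / scaled_det t s.
Proof.
rewrite -[LHS](mulfK (scaled_det_neq0 s)); congr (_ / _).
rewrite [RHS]/scaled_det -(word_sum_det N s (fun=> t)) raddf_sum /=; congr (_ * _); apply: eq_bigr => w _.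
by rewrite rmorph_prod; apply: eq_bigr => k _; rewrite /= mevalXU.
Qed.

(** Since (t^i)^(l_j) = (t^(l_j))^i, the specialized alternant is a Vandermonde determinant in the
    t^(l_j). *)
Lemma meval_alternant N (l : 'I_N -> nat) :
  meval (fun i : 'I_N => t ^+ i) (alternant K l) =
  \prod_(i < N) \prod_(k < N | (i < k)%N) (t ^+ l k - t ^+ l i).
Proof.
rewrite /alternant -det_map_mx.
have -> : map_mx (meval (fun i : 'I_N => t ^+ i)) (\matrix_(i, j) 'X_i ^+ l j) =
    Vandermonde N (\row_j t ^+ l j).
  by apply/matrixP=> i j; rewrite !mxE rmorphXn /= mevalXU -!exprM mulnC.
rewrite det_Vandermonde; apply: eq_bigr => i _; apply: eq_bigr => k _.
by rewrite !mxE.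
Qed.

Lemma prod_diff_powers N (l : 'I_N -> nat) :
  (forall i k : 'I_N, (i < k)%N -> (l k <= l i)%N) ->
  \prod_(i < N) \prod_(k < N | (i < k)%N) (t ^+ l k - t ^+ l i) =
  t ^+ (\sum_(k < N) k * l k) * \prod_(i < N) \prod_(k < N | (i < k)%N) (1 - t ^+ (l i - l k)).
Proof.
move=> l_le.
have -> : (\sum_(k < N) k * l k = \sum_(i < N) \sum_(k < N | i < k) l k)%N.
  rewrite (exchange_big_dep xpredT) //=; apply: eq_bigr => k _.
  rewrite sum_nat_const; congr (_ * _)%N.
  rewrite -sum1_card -(big_ord_widen N (fun=> 1%N) (ltnW (ltn_ord k))).
  by rewrite sum1_card card_ord.
rewrite expr_sum -big_split; apply: eq_bigr => i _ /=.
rewrite expr_sum -big_split; apply: eq_bigr => k ik /=.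
by rewrite mulrBr mulr1 -exprD subnKC // l_le.
Qed.

Let box_prod (F : nat -> nat -> K) : K :=
  \prod_(i < size lam) \prod_(c < nth 0%N lam i) F i c.

Let box_prodE N (F : nat -> nat -> K) : (size lam <= N)%N ->
  box_prod F = \prod_(i < N) \prod_(c < nth 0%N lam i) F i c.
Proof.
move=> leN; rewrite /box_prod.
rewrite (big_ord_widen N (fun i => \prod_(c < nth 0%N lam i) F i c) leN) big_mkcond.
apply: eq_bigr => i _; case: ltnP => // le_i.
by rewrite nth_default // big_ord0.
Qed.

(** [prod_hooks_row] is used for [lam] and for the empty partition. In row i the quotient of the
    products of 1 - t^m over m <= delta_i + lam_i and over m <= delta_i leaves the exponents N + c -
    i. *)
Lemma hook_content_alternant N : (size lam <= N)%N ->
  (\prod_(i < N) \prod_(k < N | (i < k)%N)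
     (t ^+ shifted_part lam k - t ^+ shifted_part lam i)) *
    box_prod (fun i c => 1 - t ^+ hook_length lam i c) =
  (\prod_(i < N) \prod_(k < N | (i < k)%N) (t ^+ delta k - t ^+ delta i)) *
    (t ^+ part_n lam * box_prod (fun i c => 1 - t ^+ N * (t ^+ c / t ^+ i))).
Proof.
move=> leN; rewrite !prod_diff_powers; first last.
- move=> i k ik; have := nth_part_le lamP (ltnW ik); rewrite /shifted_part /delta; lia.
- by move=> i k ik; rewrite /delta; lia.
have -> : (\sum_(k < N) k * shifted_part lam k = \sum_(k < N) k * delta k + part_n lam)%N.
  rewrite /part_n (big_ord_widen N (fun k => k * nth 0%N lam k)%N leN).
  rewrite [X in (_ + X)%N]big_mkcond -big_split; apply: eq_bigr => k _ /=.
  rewrite /shifted_part mulnDr addnC; congr (_ + _)%N.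
  by case: ltnP => // le_k; rewrite nth_default ?muln0.
rewrite exprD !(box_prodE _ leN) -!mulrA; congr (_ * _).
rewrite [RHS]mulrCA; congr (_ * _).
rewrite -!big_split; apply: eq_bigr => i _ /=.
rewrite (prod_hooks_row lamP (fun m => 1 - t ^+ m) i leN).
have nilP : is_partition 0 [::] by [].
have := prod_hooks_row nilP (fun m => 1 - t ^+ m) i (leq0n N).
rewrite nth_nil big_ord0 mulr1.
have -> : \prod_(k < N | (i < k)%N) (1 - t ^+ (shifted_part [::] i - shifted_part [::] k)) =
    \prod_(k < N | (i < k)%N) (1 - t ^+ (delta i - delta k)).
  by apply: eq_bigr => k _; rewrite /shifted_part !nth_nil !add0n.
move=> ->.
have -> : shifted_part [::] i = delta i by rewrite /shifted_part nth_nil.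
have -> : shifted_part lam i = (delta i + nth 0%N lam i)%N by rewrite addnC.
rewrite big_split_ord /=; congr (_ * _).
apply: eq_bigr => c _; congr (1 - _).
apply: (mulIf (expf_neq0 i t_neq0)); rewrite -mulrA divfK ?expf_neq0 // -!exprD.
by congr (t ^+ _); rewrite /delta; have := ltn_ord i; lia.
Qed.

Lemma box_prod_hook_neq0 : box_prod (fun i c => 1 - t ^+ hook_length lam i c) != 0.
Proof.
apply/prodf_neq0=> i _; apply/prodf_neq0=> c _.
by rewrite subr_eq0 eq_sym t_neq1.
Qed.

Lemma hook_content_power N : (size lam <= N.+1)%N ->
  young_sum lam (fun s => scaled_det (t ^+ N.+1) s / scaled_det t s : K^o) =
  young_scalar n lam K * (t ^+ part_n lam *
    (box_prod (fun i c => 1 - t ^+ N.+1 * (t ^+ c / t ^+ i)) /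
     box_prod (fun i c => 1 - t ^+ hook_length lam i c))).
Proof.
move=> leN; have := congr1 (meval (fun i : 'I_N.+1 => t ^+ i))
  (frobenius_formula lamP pcharK leN scalar_neq0).
rewrite rmorphM /= mevalZ !meval_alternant.
have -> : meval (fun i : 'I_N.+1 => t ^+ i) (young_sum lam (@power_sum K n N.+1)) =
    young_sum lam (fun s => scaled_det (t ^+ N.+1) s / scaled_det t s : K^o).
  rewrite raddf_sum; apply: eq_bigr => r _; rewrite raddf_sum; apply: eq_bigr => c _ /=.
  by rewrite mevalZ meval_power_sum.
set D := \prod_i \prod_(k | _) (t ^+ delta k - _).
have D_neq0 : D != 0.
  apply/prodf_neq0=> i _; apply/prodf_neq0=> k ik.
  have -> : delta i = (delta k + (k - i).-1.+1)%N.
    by rewrite /delta prednK ?subn_gt0 //; have := ltn_ord k; lia.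
  rewrite exprD -{1}[t ^+ delta k]mulr1 -mulrBr mulf_neq0 ?expf_neq0 //.
  by rewrite subr_eq0 eq_sym t_neq1.
move=> E; apply: (mulIf D_neq0); rewrite E -mulrA; congr (_ * _).
apply: (mulIf box_prod_hook_neq0); rewrite (hook_content_alternant leN).
have := box_prod_hook_neq0; move: (box_prod _) (box_prod _) => x y y0.
by rewrite -/D; field.
Qed.

(* Both sides are polynomials in u that agree at u = t ^ N for all large N.   *)
Lemma hook_content_formula (u : K) :
  young_sum lam (fun s => scaled_det u s / scaled_det t s : K^o) =
  young_scalar n lam K * (t ^+ part_n lam *
    \prod_(i < size lam) \prod_(c < nth 0%N lam i)
      ((1 - u * (t ^+ c / t ^+ i)) / (1 - t ^+ hook_length lam i c))).
Proof.
pose a : {poly K} := young_sum lam (fun s => (scaled_det t s)^-1 *: scaled_det 'X s).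
pose b : {poly K} := (young_scalar n lam K * (t ^+ part_n lam /
    box_prod (fun i c => 1 - t ^+ hook_length lam i c))) *:
  \prod_(i < size lam) \prod_(c < nth 0%N lam i) (1 - (t ^+ c / t ^+ i) *: 'X).
have aE x : a.[x] = young_sum lam (fun s => scaled_det x s / scaled_det t s : K^o).
  rewrite horner_sum; apply: eq_bigr => r _; rewrite horner_sum; apply: eq_bigr => c _.
  by rewrite !hornerZ horner_scaled_det; congr (_ * _); rewrite mulrC.
have bE x : b.[x] = young_scalar n lam K * (t ^+ part_n lam *
    (box_prod (fun i c => 1 - x * (t ^+ c / t ^+ i)) /
     box_prod (fun i c => 1 - t ^+ hook_length lam i c))).
  rewrite hornerZ horner_prod -!mulrA; congr (_ * (_ * _)).
  rewrite mulrC; congr (_ / _).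
  apply: eq_bigr => i _; rewrite horner_prod; apply: eq_bigr => c _.
  rewrite !hornerE /= [LHS]addrC [RHS]addrC; congr (- _ + _). by rewrite mulrC mulrA.
suff ab : a = b.
  rewrite -aE ab bE; congr (_ * (_ * _)); rewrite /box_prod -prodf_div.
  by apply: eq_bigr => i _; rewrite -prodf_div.
apply/eqP; rewrite -subr_eq0; apply/eqP.
(* Exponents large enough for [hook_content_power], and as many as force [a - b] to vanish; the
   powers are distinct since [t] is not a root of unity. *)
pose rs := [seq t ^+ (size lam + k).+1 | k <- iota 0 (size (a - b))].
apply: (@roots_geq_poly_eq0 _ _ rs); last by rewrite size_map size_iota.
  apply/allP=> _ /mapP[k _ ->]; rewrite rootE hornerD hornerN aE bE hook_content_power ?subrr //.
  by rewrite leqW ?leq_addr.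
rewrite map_inj_uniq ?iota_uniq // => k l.
wlog kl : k l / (k <= l)%N => [H E|E].
  by case: (leqP k l) => [/H->|/ltnW/H->].
have [/eqP|[m lE]] : (l - k == 0)%N \/ exists m, (l - k = m.+1)%N.
- by case: (l - k)%N => [|m]; [left | right; exists m].
- by lia.
have lk : ((size lam + l).+1 = (size lam + k).+1 + m.+1)%N by lia.
move/eqP: E; rewrite lk exprD -{1}[t ^+ _]mulr1.
by rewrite (inj_eq (mulfI (expf_neq0 _ t_neq0))) eq_sym (negbTE (t_neq1 m)).
Qed.

End Specialization.

(** * Characters of the Specht modules *)

(** For a rank factorization A = L R, A^2 = 0 gives R L = 0, and tr A = tr (R L). *)
Lemma mxtrace_sqr0 (F : fieldType) m (A : 'M[F]_m) : A *m A = 0 -> \tr A = 0.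
Proof.
move=> AA; have /row_fullP[B BA] := col_base_full A.
have /row_freeP[C AC] := row_base_free A.
move: (\rank A) (col_base A) (row_base A) B BA C AC (mulmx_base A) => k L R B BL C RC LR.
have RL0 : R *m L = 0.
  rewrite -[R *m L]mulmx1 -RC -[_ *m _]mul1mx -BL.
  have -> : B *m L *m (R *m L *m (R *m C)) = B *m (A *m A) *m C by rewrite -LR !mulmxA.
  by rewrite AA mulmx0 mul0mx.
by rewrite -LR mxtrace_mulC RL0 mxtrace0.
Qed.

Section SpechtTrace.

Variables (n : nat) (lam : seq nat).
Hypothesis lamP : is_partition n lam.

Local Notation G := [set: 'S_n].
Local Notation kappa := (young_scalar n lam algC).
Local Notation rG := (regular_repr algC G).
Local Notation basis := (@gring_basis n).

Let C2 : 2%:R != 0 :> algC.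
Proof. by rewrite pnatr_eq0. Qed.

Lemma gring_basis_mul s x : basis s *m rG x = basis (s * x)%g.
Proof. by rewrite -rowE rowK gring_indexK ?inE. Qed.

(** Left multiplication by the Young symmetrizer, whereas [rG] acts by right multiplication. *)
Definition left_young : 'M[algC]_(gcard G) :=
  \matrix_i young_sum lam (fun x => basis (x * enum_val i)%g).

Lemma gring_basis_left s :
  basis s *m left_young = young_sum lam (fun x => basis (x * s)%g).
Proof. by rewrite -rowE rowK gring_indexK ?inE. Qed.

Lemma young_sum_mulmx m (phi : 'S_n -> 'rV[algC]_m) p (A : 'M_(m, p)) :
  young_sum lam phi *m A = young_sum lam (fun x => phi x *m A).
Proof.
rewrite mulmx_suml; apply: eq_bigr => r _; rewrite mulmx_suml.
by apply: eq_bigr => c _; rewrite -scalemxAl.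
Qed.

Lemma young_sum_exchange (V : lmodType algC) (phi : 'S_n -> 'S_n -> V) :
  young_sum lam (fun x => young_sum lam (phi x)) =
  young_sum lam (fun y => young_sum lam (fun x => phi x y)).
Proof.
rewrite {2}/young_sum young_sum_sum; apply: eq_bigr => r _.
rewrite young_sum_sum; apply: eq_bigr => c _.
rewrite scaler_sumr; apply: eq_bigr => r' _; rewrite scaler_sumr; apply: eq_bigr => c' _.
by rewrite !scalerA mulrC.
Qed.

Lemma left_young_sqr : left_young *m left_young = kappa *: left_young.
Proof.
apply/row_matrixP=> i; rewrite row_mul linearZ /= rowK young_sum_mulmx.
rewrite -(young_sum_idem lamP C2 (fun x => basis (x * enum_val i)%g)) young_sum_exchange.
apply: eq_bigr => r _; apply: eq_bigr => c _; congr (_ *: _).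
by rewrite gring_basis_left; apply: eq_bigr => r' _; apply: eq_bigr => c' _; rewrite !mulgA.
Qed.

Lemma mxtrace_left_young s :
  \tr (left_young *m rG s) = \sum_(g : 'S_n) young_sum lam (fun x => (x * g * s == g)%g%:R : algC^o).
Proof.
transitivity (\sum_(g in G) young_sum lam (fun x => (x * g * s == g)%g%:R : algC^o)).
  rewrite (big_enum_val (fun g => young_sum lam (fun x => (x * g * s == g)%g%:R : algC^o))).
  apply: eq_bigr => i _.
  have -> : (left_young *m rG s) i i = row i (left_young *m rG s) 0 i by rewrite [RHS]mxE.
  rewrite row_mul rowK young_sum_mulmx /young_sum summxE; apply: eq_bigr => r _.
  rewrite summxE; apply: eq_bigr => c _; rewrite gring_basis_mul !mxE eqxx /=.
  congr (_ * _%:R); congr nat_of_bool.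
  by apply/eqP/eqP => [{2}->|->]; rewrite ?gring_indexK ?gring_valK ?inE.
by apply: eq_bigl => g; rewrite inE.
Qed.

(** The symmetrizer has coefficient 1 at the identity, so left multiplication by it has trace n!;
    with kappa = 0 it would square to zero and have trace 0. *)
Lemma young_scalar_neq0 : kappa != 0.
Proof.
apply/eqP=> k0; have := left_young_sqr; rewrite k0 scale0r => /mxtrace_sqr0.
rewrite -[left_young]mulmx1 -(repr_mx1 rG) mxtrace_left_young.
have -> : \sum_(g : 'S_n) young_sum lam (fun x => (x * g * 1 == g)%g%:R : algC^o) = n`!%:R.
  rewrite (eq_bigr (fun=> 1)) => [|g _]; first by rewrite sumr_const card_Sn.
  transitivity (young_coef lam algC (1 * 1 : 'S_n)%g).
    apply: eq_bigr => r _; apply: eq_bigr => c _; rewrite -[LHS]/(_ * _) -[RHS]mulr_natr; congr (_ * _%:R).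
    by rewrite !mulg1 -{2}[g]mul1g (inj_eq (mulIg g)).
  by rewrite young_coef_mul ?group1 // odd_perm1.
by move/eqP; rewrite pnatr_eq0 gtn_eqF ?fact_gt0.
Qed.

(** Left multiplication by the symmetrizer maps the group algebra into the Specht module and acts on
    the module as kappa. Hence kappa times the trace of [s] on the module is a trace on the whole
    group algebra. *)
Lemma mxtrace_specht s :
  \tr (specht_repr n lam s) =
  kappa^-1 * \sum_(g : 'S_n) young_sum lam (fun x => (x * g * s == g)%g%:R : algC^o).
Proof.
apply: (mulfI young_scalar_neq0); rewrite mulVKf ?young_scalar_neq0 //.
rewrite -mxtrace_left_young.
set Y := young_symmetrizer n lam; set U := cyclic_mx rG Y.
have Umod : mxmodule rG U := cyclic_mx_module rG Y.
have rowE (g : 'S_n) : Y *m rG g = young_sum lam (fun x => basis (x * g)%g).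
  rewrite (young_sum_mulmx basis); apply: eq_bigr => r _; apply: eq_bigr => c _.
  by rewrite gring_basis_mul.
have left_sub : (left_young <= U)%MS.
  apply/row_subP=> i; rewrite rowK -rowE; apply/cyclic_mxP.
  by exists (rG (enum_val i)) => //; rewrite envelop_mx_id ?inE.
have left_scal m (A : 'M_(m, gcard G)) : (A <= U)%MS -> A *m left_young = kappa *: A.
  move=> AU; apply/row_matrixP=> i; rewrite row_mul linearZ /=.
  have /cyclic_mxP[B /envelop_mxP[a ->] ->] : (row i A <= U)%MS := submx_trans (row_sub i A) AU.
  rewrite mulmx_sumr mulmx_suml scaler_sumr; apply: eq_bigr => g Gg.
  rewrite -scalemxAr -scalemxAl scalerA mulrC -scalerA; congr (_ *: _).
  have -> : Y *m rG g = row (gring_index G g) left_young by rewrite rowK gring_indexK ?rowE.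
  by rewrite -row_mul left_young_sqr linearZ.
pose M := in_submod U left_young; pose A := val_submod (1%:M : 'M_(\rank U)).
have AM : A *m M = kappa%:M.
  rewrite /M in_submodE mulmxA -in_submodE left_scal ?val_submodP //.
  by rewrite linearZ /= val_submodK scalemx1.
have MA : M *m A = left_young by rewrite -val_submodE in_submodK.
rewrite -MA -mulmxA.
have -> : A *m rG s = submod_mx Umod s *m A.
  by rewrite -val_submodE -[submod_mx _ _]mul1mx val_submodJ ?inE.
rewrite [in RHS](mxtrace_mulC M) -mulmxA AM mul_mx_scalar mxtraceZ.
by [].
Qed.

End SpechtTrace.

(** * The fake degree *)

Section ScaledDet.

Variables (n : nat) (R : comNzRingType) (u : R).
Implicit Types s g : 'S_n.

Lemma scaled_detE s : scaled_det u s = \det (1%:M - u *: perm_mx s).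
Proof. by congr (\det (_ - _)); apply/matrixP=> i j; rewrite !mxE mulr_natr. Qed.

Lemma scaled_detV s : scaled_det u s^-1 = scaled_det u s.
Proof.
by rewrite !scaled_detE -det_tr linearB /= linearZ /= tr_perm_mx invgK tr_scalar_mx.
Qed.

Lemma scaled_detJ s g : scaled_det u (s ^ g)%g = scaled_det u s.
Proof.
rewrite !scaled_detE conjgE !perm_mxM.
have gVg : perm_mx g^-1%g *m perm_mx g = 1%:M :> 'M[R]_n by rewrite -perm_mxM mulVg perm_mx1.
have -> : 1%:M - u *: (perm_mx g^-1%g *m (perm_mx s *m perm_mx g)) =
    perm_mx g^-1%g *m (1%:M - u *: perm_mx s) *m perm_mx g.
  by rewrite mulmxBr mulmxBl mulmx1 gVg -scalemxAr -scalemxAl mulmxA.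
by rewrite !det_mulmx mulrAC -det_mulmx gVg det1 mul1r.
Qed.

End ScaledDet.

(** * Signed permutations as pairs of a permutation and a sign vector *)

Section SignedPermutations.

Variable n : nat.

Definition signed_fun (p : 'S_n * {ffun 'I_n -> bool}) (x : 'I_n * bool) :=
  (p.1 x.1, x.2 (+) p.2 x.1).

Lemma signed_fun_inj p : injective (signed_fun p).
Proof. by move=> [i a] [j b] [/perm_inj -> /addIb ->]. Qed.

Definition signs (w : {perm 'I_n * bool}) : {ffun 'I_n -> bool} :=
  [ffun i => (w (i, false)).2].

Lemma sum_hyperoctahedral (V : nmodType) (H : 'S_n -> {ffun 'I_n -> bool} -> V) :
  \sum_(w in hyperoctahedral n) H (unsigned w) (signs w) = \sum_s \sum_e H s e.
Proof.
rewrite pair_bigA /=.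
pose h p : {perm 'I_n * bool} := perm (@signed_fun_inj p).
rewrite (reindex_onto h (fun w => (unsigned w, signs w))) /= => [|w Ww]; last first.
  apply/permP=> -[i b]; rewrite permE /signed_fun /= unsignedE // ffunE.
  case: b => /=; last by rewrite -surjective_pairing.
  have -> : (i, true) = neg_index (i, false) by [].
  by rewrite hyperoctahedralN.
have hW p : h p \in hyperoctahedral n.
  apply/cent1P/permP=> -[i b]; rewrite !permM /h !permE.
  by rewrite /signed_fun /neg_index /= addNb.
have hK p : (unsigned (h p), signs (h p)) = p.
  have hE i : h p (i, false) = (p.1 i, p.2 i) by rewrite permE /signed_fun /=.
  rewrite [RHS]surjective_pairing; congr (_, _); last by apply/ffunP=> i; rewrite ffunE hE.
  by apply/permP=> i; rewrite unsignedE ?hW // hE.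
apply: eq_big => [p|p _]; first by rewrite hW hK eqxx.
by have [] := (hK p, hK p) => /(congr1 fst) /= -> /(congr1 snd) /= ->.
Qed.

Lemma card_hyperoctahedral : #|hyperoctahedral n| = (2 ^ n * n`!)%N.
Proof.
rewrite -sum1_card (sum_hyperoctahedral (fun _ _ => 1%N)) /=.
rewrite !sum_nat_const muln1 card_Sn card_ffun card_bool card_ord mulnC.
done.
Qed.

End SignedPermutations.

(** The scalar is an integer combination of signs; its nonvanishing thus passes from [algC] to
    [ratfun]. *)
Lemma rmorph_young_scalar (K K' : fieldType) (f : {rmorphism K -> K'}) n lam :
  f (young_scalar n lam K) = young_scalar n lam K'.
Proof.
rewrite rmorph_sum; apply: eq_bigr => r _; rewrite rmorph_sum; apply: eq_bigr => c _.
rewrite rmorphM /= rmorph_sign rmorph_sum; congr (_ * _).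
apply: eq_bigr => r' _; rewrite rmorph_sum; apply: eq_bigr => c' _.
by rewrite rmorphMn /= rmorph_sign.
Qed.

Lemma pchar_ratfun : [pchar ratfun] =i pred0.
Proof.
apply/pcharf0P=> m; rewrite -(rmorph_nat (@tofrac {poly algC})) tofrac_eq0.
by rewrite -polyC_natr polyC_eq0 pnatr_eq0.
Qed.

Lemma divf_mulK (F : fieldType) (x y z : F) : y != 0 -> x / (y * z) * y = x / z.
Proof. by move=> y0; rewrite invfM mulrA mulrAC divfK. Qed.

Lemma divf_chainK (F : fieldType) (x y z : F) : y != 0 -> z != 0 -> x / y * y / z * z = x.
Proof. by move=> y0 z0; rewrite !divfK. Qed.

Lemma exprz_content (F : fieldType) (x : F) i j : x != 0 ->
  x ^ (2 * content i j + 1) = x * ((x ^+ 2) ^+ j / (x ^+ 2) ^+ i).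
Proof.
move=> x0; rewrite expfzDr // mulrC; congr (_ * _).
rewrite -exprz_exp /content expfzDr ?expfz_neq0 //.
by rewrite -exprz_inv; congr (_ * _); apply: exprVn.
Qed.

Lemma qvar_neq0 : qvar != 0.
Proof. by rewrite tofrac_eq0 polyX_eq0. Qed.

Lemma qvarX_neq1 m : qvar ^+ m.+1 != 1.
Proof.
rewrite -rmorphXn /= -(rmorph1 (@tofrac {poly algC})) tofrac_eq.
apply/eqP=> /(congr1 (fun p : {poly algC} => size p)); rewrite size_polyXn size_poly1.
by [].
Qed.

(** * Reduction of the fake degree to the symmetrizer *)

Section Assembly.

Variables (n : nat) (lam : seq nat).
Hypothesis lamP : is_partition n lam.

Local Notation kappa := (young_scalar n lam ratfun).

(** In the trace formula x g s = g leaves only s = g^-1 x^-1 g, where [f] takes the value f(x), so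
    each of the n! elements g contributes the same sum. *)
Lemma sum_specht_class_fun (f : 'S_n -> ratfun) :
  (forall s g, f (s ^ g)%g = f s) -> (forall s, f s^-1%g = f s) ->
  \sum_s const_ratfun (\tr (specht_repr n lam s)) * f s =
  n`!%:R / kappa * young_sum lam (f : 'S_n -> ratfun^o).
Proof.
move=> fJ fV.
have iota s : const_ratfun (\tr (specht_repr n lam s)) =
    kappa^-1 * \sum_(g : 'S_n) young_sum lam (fun x => (x * g * s == g)%g%:R : ratfun^o).
  rewrite (mxtrace_specht lamP) -[const_ratfun _]/((@tofrac {poly algC} \o polyC) _).
  rewrite rmorphM fmorphV rmorph_young_scalar rmorph_sum; congr (_ * _).
  apply: eq_bigr => g _; rewrite rmorph_sum; apply: eq_bigr => r _.
  rewrite rmorph_sum; apply: eq_bigr => c _.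
  by rewrite rmorphM rmorph_sign rmorph_nat.
under eq_bigr => s _ do rewrite iota -mulrA mulr_suml.
rewrite -mulr_sumr exchange_big /= [n`!%:R * _]mulrC -mulrA; congr (_ * _).
have -> : n`!%:R * young_sum lam (f : 'S_n -> ratfun^o) = \sum_(g : 'S_n) young_sum lam (f : 'S_n -> ratfun^o).
  by rewrite sumr_const card_Sn mulr_natl.
apply: eq_bigr => g _; under eq_bigr => s _ do rewrite mulr_suml.
rewrite exchange_big; apply: eq_bigr => r _ /=.
under eq_bigr => s _ do rewrite mulr_suml.
rewrite exchange_big; apply: eq_bigr => c _ /=.
transitivity ((-1) ^+ odd_perm c * \sum_s ((r * c * g * s == g)%g%:R * f s)).
  by rewrite mulr_sumr; apply: eq_bigr => s _; rewrite mulrA.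
rewrite -[RHS]/(_ * _); congr (_ * _).
rewrite (bigD1 ((r * c)^-1 ^ g)%g) //= big1 ?addr0 => [|s s_neq].
  by rewrite fJ fV conjgE !mulgA mulgK mulgV mul1g eqxx mul1r.
case: eqP => [E|_]; last by rewrite mul0r.
case/eqP: s_neq; rewrite conjgE; apply: (mulgI (r * c * g)%g).
by rewrite E -(mulgA (r * c)%g g) !mulKVg.
Qed.

Lemma refl_mxE w : w \in hyperoctahedral n ->
  refl_mx w = \matrix_(i, j) ((-1) ^+ signs w i *+ (unsigned w i == j)).
Proof.
move=> Ww; apply/matrixP=> i j; rewrite !mxE ffunE unsignedE //.
by case: eqP.
Qed.

(** The factor 1 is kept to match the weights of [sign_sum_det] with [x] constantly 1. *)
Lemma det_one_subE w : w \in hyperoctahedral n ->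
  const_ratfun (det_one_sub (refl_repr n) w) =
  wperm_det (fun i => (-1) ^+ signs w i * 1) (unsigned w).
Proof.
move=> Ww; rewrite /det_one_sub /= (refl_mxE Ww) -/(wperm_det _ _).
rewrite -[const_ratfun _]/((@tofrac {poly algC} \o polyC) _) rmorph_wperm_det.
by apply: eq_wperm_det => i; rewrite mulr1; apply: (rmorph_sign (@tofrac {poly algC} \o polyC)).
Qed.

Lemma det_one_sub_qE w : w \in hyperoctahedral n ->
  det_one_sub_q (refl_repr n) w =
  wperm_det (fun i => (-1) ^+ signs w i * qvar) (unsigned w).
Proof.
move=> Ww; rewrite /det_one_sub_q /= (refl_mxE Ww); congr (\det (_ - _)).
apply/matrixP=> i j; rewrite !mxE /const_ratfun.
rewrite [polyC _]rmorphMn rmorphMn /= !rmorph_sign.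
by rewrite mulrnAr mulrC.
Qed.

(** The character depends only on the unsigned permutation, so [sign_sum_det] applies with weights 1
    and q; its factor 2^n cancels against the order of W(B_n). *)
Lemma ell_fake_degree_sum :
  ell_fake_degree_cf (refl_repr n) (bipart_empty n lam) =
  (qvar - 1) ^+ n / n`!%:R *
  \sum_s const_ratfun (\tr (specht_repr n lam s)) *
    (scaled_det qvar s / scaled_det (qvar ^+ 2) s).
Proof.
rewrite /ell_fake_degree_cf.
pose H s (e : {ffun 'I_n -> bool}) := const_ratfun (\tr (specht_repr n lam s)) *
  (wperm_det (fun i => (-1) ^+ e i * 1) s / wperm_det (fun i => (-1) ^+ e i * qvar) s).
have -> : \sum_(w in hyperoctahedral n)
     const_ratfun ((bipart_empty n lam : 'CF(hyperoctahedral n)) w) *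
       (const_ratfun (det_one_sub (refl_repr n) w) / det_one_sub_q (refl_repr n) w) =
    \sum_(w in hyperoctahedral n) H (unsigned w) (signs w).
  apply: eq_bigr => w Ww; rewrite /H (det_one_subE Ww) (det_one_sub_qE Ww).
  by congr (const_ratfun _ * _); rewrite cfunE Ww mulr1n.
rewrite sum_hyperoctahedral card_hyperoctahedral.
have two_neq0 : 2 != 0 :> ratfun by have /pcharf0P -> := pchar_ratfun.
have fact_neq0 : n`!%:R != 0 :> ratfun.
  by have /pcharf0P -> := pchar_ratfun; rewrite gtn_eqF ?fact_gt0.
have -> : \sum_s \sum_e H s e = 2 ^+ n * \sum_s const_ratfun (\tr (specht_repr n lam s)) *
    (scaled_det qvar s / scaled_det (qvar ^+ 2) s).
  rewrite mulr_sumr; apply: eq_bigr => s _; rewrite -mulr_sumr mulrCA; congr (_ * _).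
  rewrite (@sign_sum_det _ _ (pos_power qvar)).
  - have q1 : (fun=> 1 * qvar : ratfun) =1 (fun=> qvar : ratfun) :> ('I_n -> ratfun).
      by move=> k; exact: mul1r.
    by rewrite (eq_wperm_det s q1).
  - by left.
  - exact: pos_powerM.
  - exact: pos_power_neq1 qvarX_neq1.
  by move=> _; right; exists 0%N.
rewrite natrM natrX mulrA; congr (_ * _).
exact: divf_mulK (expf_neq0 n two_neq0).
Qed.

End Assembly.

Theorem proposition2p11 (n : nat) (lam : seq nat)
    (hn : (1 <= n)%N) (hlam : is_partition n lam) :
  ell_fake_degree (ell_class (refl_repr n) (bipart_empty n lam)) =
    (qvar - 1) ^+ n * qvar ^+ (2 * part_n lam) *
    \prod_(i < size lam) \prod_(j < nth 0%N lam i)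
       ((1 - qvar ^ (2 * content i j + 1)) /
        (1 - qvar ^+ (2 * hook_length lam i j))).
Proof.
have kappa_neq0 : young_scalar n lam ratfun != 0.
  rewrite -(rmorph_young_scalar (@tofrac {poly algC} \o polyC)) fmorph_eq0.
  exact: young_scalar_neq0.
rewrite ell_fake_degreeE ell_fake_degree_sum.
rewrite (sum_specht_class_fun hlam (f := fun s => scaled_det qvar s / scaled_det (qvar ^+ 2) s)); first last.
- by move=> s; rewrite !scaled_detV.
- by move=> s g; rewrite !scaled_detJ.
have t_neq0 : qvar ^+ 2 != 0 by rewrite expf_neq0 ?qvar_neq0.
have t_neq1 m : (qvar ^+ 2) ^+ m.+1 != 1 by rewrite -exprM mulnS qvarX_neq1.
(* Here t = q^2 and u = q, so u t^c / t^i = q^(2(c - i) + 1), while n! and kappa cancel. *)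
rewrite (hook_content_formula hlam pchar_ratfun kappa_neq0 t_neq0 t_neq1).
have fact_neq0 : n`!%:R != 0 :> ratfun.
  by have /pcharf0P -> := pchar_ratfun; rewrite gtn_eqF ?fact_gt0.
rewrite -exprM.
transitivity ((qvar - 1) ^+ n * (qvar ^+ (2 * part_n lam) *
  \prod_(i < size lam) \prod_(c < nth 0%N lam i)
   ((1 - qvar * ((qvar ^+ 2) ^+ c / (qvar ^+ 2) ^+ i)) / (1 - (qvar ^+ 2) ^+ hook_length lam i c)))).
  rewrite !mulrA; do 2!congr (_ * _).
  exact: divf_chainK fact_neq0 kappa_neq0.
rewrite mulrA; congr (_ * _); apply: eq_bigr => i _; apply: eq_bigr => c _.
by rewrite (exprz_content _ _ qvar_neq0) [in RHS]exprM.
Qed.
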